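(* Let $1\le p<p'$ be coprime integers, let $1\le r\le p-1$ and $1\le b,s\le p'-1$, put $\lambda=|b-s|$, and let $N\ge 1$, $k\ge 0$ and $0\le \ell<N$ be integers such that $\ell+\lambda+N(kb+r)$ is even. Let $\sigma\in\{0,1\}$ with $\sigma\equiv kb+r \pmod 2$. Let $\alpha^{(k)}=\{\alpha^{(k)}_L\}_{L\ge0}$ be the $\alpha$-sequence of the ($k$ times iterated) Bailey pair relative to $q^{\lambda}$ coming from the $M(p,p')$ polynomials, as defined in the context. Then $$\frac{1}{(q)_\infty}\sum_{L=0}^{\infty}q^{L(L+\lambda)/N}\,\alpha^{(k)}_L\sum_{\substack{\eta\in\mathbb{Z}_{\ge0}^{N-1}\\ \frac{L+(\lambda-\ell)/2}{N}-(C^{-1}\eta)_1\in\mathbb{Z}+\frac{\sigma}{2}}}\frac{q^{\eta^{T}C^{-1}(\eta-e_\ell)}}{(q)_{\eta_1}\cdots(q)_{\eta_{N-1}}}=\hat\chi^{(p',\,p'+N(p+kp');\,N)}_{s,\;b+N(kb+r);\;\ell}(q).$$ That is, there is a Bailey flow $M(p,p')=(p,p')_1\to (p',p'+N(kp'+p))_N$.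
   Context: Notation: $(q)_n=\prod_{i=1}^n(1-q^i)$, $(q)_\infty=\prod_{i\ge1}(1-q^i)$; all identities are between formal series in (fractional powers of) $q$. $C$ is the Cartan matrix of $A_{N-1}$, $C_{ij}=2\delta_{ij}-\delta_{|i-j|,1}$, $1\le i,j\le N-1$, so $(C^{-1})_{ij}=\min\{i,j\}-ij/N$. $e_i$ is the $i$-th unit vector in $\mathbb{Z}^{N-1}$ and $e_i=0$ for $i\notin\{1,\dots,N-1\}$. For $N=1$ the sums over vectors have just the empty vector, with $(C^{-1}\eta)_1=0$. The sequence $\alpha^{(k)}$ (terms whose positions coincide are added): $$\alpha^{(k)}_L=\delta_{L,0}+\sum_{j\ge1}\Bigl(q^{j(jp'(p+kp')+p'(r+kb)-s(p+kp'))}\delta_{L,\,jp'-(\lambda-b+s)/2}+q^{j(jp'(p+kp')-p'(r+kb)+s(p+kp'))}\delta_{L,\,jp'-(\lambda+b-s)/2}\Bigr)$$ $$-\sum_{j\ge0}q^{(jp'+s)(j(p+kp')+kb+r)}\delta_{L,\,jp'-(\lambda-b-s)/2}-\sum_{j\ge1}q^{(jp'-s)(j(p+kp')-kb-r)}\delta_{L,\,jp'-(\lambda+b+s)/2}.$$ Level-$N$ $A_1^{(1)}$ string functions ($0\le\ell\le N$, $m+\ell$ even): $$c^\ell_m(q)=\frac{q^{\frac{\ell(N-\ell)}{2N(N+2)}}}{(q)_\infty}\sum_{\substack{n\in\mathbb{Z}_{\ge0}^{N-1}\\ \frac{m+\ell}{2N}+(C^{-1}n)_1\in\mathbb{Z}}}\frac{q^{n^TC^{-1}(n-e_\ell)}}{(q)_{n_1}\cdots(q)_{n_{N-1}}};$$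 they satisfy $c^\ell_m=c^\ell_{-m}=c^\ell_{m+2N}=c^{N-\ell}_{N-m}$. The coset $(P,P')_N$ denotes $(A^{(1)}_1)_N\times(A_1^{(1)})_{N'}/(A^{(1)}_1)_{N+N'}$ with $N'=NP/(P'-P)-2$, where $P<P'$, $P'-P\equiv0\bmod N$, $\gcd((P'-P)/N,P')=1$; $M(p,p')=(p,p')_1$ is the minimal model. Its normalized branching functions are, for $1\le R\le P-1$, $1\le S\le P'-1$, $0\le\ell\le N$, $R-S\equiv\ell\bmod 2$, $$\hat\chi^{(P,P';N)}_{R,S;\ell}(q)=q^{-\frac{\ell(N-\ell)}{2N(N+2)}}\sum_{0\le m\le N/2}c^\ell_{2m}(q)\Biggl(\sum_{\substack{j\in\mathbb{Z}\\ \mu_{R-S}(j)\equiv\pm m\bmod N}}q^{\frac jN(jPP'+P'R-PS)}-\sum_{\substack{j\in\mathbb{Z}\\ \mu_{R+S}(j)\equiv\pm m\bmod N}}q^{\frac1N(jP'+S)(jP+R)}\Biggr),$$ where $\mu_a(j)=a/2+P'j$ and $m$ runs over integers if $\ell$ is even and over half-odd-integers if $\ell$ is odd. *)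

(* Defs.v *)
From HB Require Import structures.
From mathcomp Require Import all_boot all_order all_algebra.
From mathcomp Require Import mathcomp_extra boolp classical_sets functions.
From mathcomp Require Import cardinality fsbigop.
From mathcomp Require Import lra.

Set Implicit Arguments.
Unset Strict Implicit.
Unset Printing Implicit Defensive.

Import Order.TTheory GRing.Theory Num.Theory.

Local Open Scope classical_set_scope.
Local Open Scope ring_scope.

(* Formal series in fractional powers of q with integer coefficients:
   functions from exponents to coefficients, nonzero at only finitely many
   exponents below any bound, so that products are defined. *)
Record qseries := QSeries {
  qcoef :> rat -> int;
  _ : forall c : rat, finite_set [set a | a <= c /\ qcoef a != 0]
}.

HB.instance Definition _ := gen_eqMixin qseries.
HB.instance Definition _ := gen_choiceMixin qseries.

Section QSeriesRing.
Implicit Types (x y z : qseries) (a c e : rat).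

Lemma qseries_finite x c : finite_set [set a | a <= c /\ x a != 0].
Proof. by case: x. Qed.

Lemma qseriesP x y : x =1 y -> x = y.
Proof.
case: x y => [f Hf] [g Hg] /= /funext fg; rewrite -fg in Hg *.
by congr QSeries; exact: Prop_irrelevance.
Qed.

Lemma qseries_bounded x : exists m, forall a, x a != 0 -> m <= a.
Proof.
have /finite_seqP[s Hs] := qseries_finite x 0.
exists (\big[Order.min/0]_(a <- s) a) => a xa.
have [a0|/ltW a0] := leP a 0; last by apply: le_trans a0; exact: bigmin_le_id.
apply: ge_bigmin_seq => //.
by have : [set` s] a by rewrite -Hs.
Qed.

Lemma qadd_subproof x y c :
  finite_set [set a | a <= c /\ x a + y a != 0].
Proof.
apply: (@sub_finite_set _ _
  ([set a | a <= c /\ x a != 0] `|` [set a | a <= c /\ y a != 0])); last first.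
  by rewrite finite_setU; split; exact: qseries_finite.
move=> a [ac]; have [->|xa _] := eqVneq (x a) 0; last by left.
by rewrite add0r => ya; right.
Qed.

Lemma qopp_subproof x c : finite_set [set a | a <= c /\ - x a != 0].
Proof.
apply: sub_finite_set (qseries_finite x c) => a [ac].
by rewrite oppr_eq0.
Qed.

Lemma qpow_subproof e c :
  finite_set [set a | a <= c /\ (a == e)%:R != 0 :> int].
Proof.
apply: (@sub_finite_set _ _ [set e]); last exact: finite_set1.
by move=> a [_]; case: (a =P e).
Qed.

Lemma qzero_subproof c :
  finite_set [set a : rat | a <= c /\ 0 != 0 :> int].
Proof. by apply: (@sub_finite_set _ _ set0) => // a [_]; rewrite eqxx. Qed.

Lemma fsum_setT (F : rat -> int) (A : set rat) :
  (forall a, F a != 0 -> A a) ->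
  \sum_(a \in [set: rat]) F a = \sum_(a \in A) F a.
Proof.
move=> FA; apply/esym/fsbig_widen => // a [_ nA] /=.
by apply: contra_notP nA => /eqP; exact: FA.
Qed.

Definition qmulf x y e : int := \sum_(a \in [set: rat]) x a * y (e - a).

Lemma mulz_neq0 (i j : int) : i * j != 0 -> i != 0 /\ j != 0.
Proof. by rewrite mulf_eq0 negb_or => /andP. Qed.

Lemma qmulf_neq0 x y e :
  qmulf x y e != 0 -> exists a, x a != 0 /\ y (e - a) != 0.
Proof.
apply: contra_neqP => /forallNP H; apply: fsbig1 => a _.
by apply: contra_notP (H a) => /eqP /mulz_neq0.
Qed.

Lemma qmul_subproof x y c : finite_set [set e | e <= c /\ qmulf x y e != 0].
Proof.
have [mx Hx] := qseries_bounded x; have [my Hy] := qseries_bounded y.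
pose A := [set a | a <= c - my /\ x a != 0].
pose B := [set a | a <= c - mx /\ y a != 0].
apply: (@sub_finite_set _ _ [set a + b | a in A & b in B]); last first.
  by apply: finite_image2; exact: qseries_finite.
move=> e [ec /qmulf_neq0[a [xa ya]]].
have xa' := Hx _ xa; have ya' := Hy _ ya.
exists a; first split => //.
  by rewrite lerBrDr (le_trans _ ec)// -lerBrDl.
exists (e - a); last by rewrite addrC subrK.
by split => //; rewrite lerB.
Qed.

Definition qzero := QSeries qzero_subproof.
Definition qadd x y := QSeries (qadd_subproof x y).
Definition qopp x := QSeries (qopp_subproof x).
Definition qpow e := QSeries (qpow_subproof e).
Definition qmul x y := QSeries (qmul_subproof x y).

Lemma qaddA : associative qadd.
Proof. by move=> x y z; apply: qseriesP => a /=; rewrite addrA. Qed.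
Lemma qaddC : commutative qadd.
Proof. by move=> x y; apply: qseriesP => a /=; rewrite addrC. Qed.
Lemma qadd0 : left_id qzero qadd.
Proof. by move=> x; apply: qseriesP => a /=; rewrite add0r. Qed.
Lemma qaddN : left_inverse qzero qopp qadd.
Proof. by move=> x; apply: qseriesP => a /=; rewrite addNr. Qed.

HB.instance Definition _ := GRing.isZmodule.Build qseries qaddA qaddC qadd0 qaddN.

Lemma qmulC : commutative qmul.
Proof.
move=> x y; apply: qseriesP => e /=; rewrite /qmulf.
rewrite (@reindex_fsbigT _ _ _ _ _ (fun a : rat => e - a)); last first.
  by exists (fun a : rat => e - a) => a /=; rewrite subKr.
by apply: eq_fsbigr => a _; rewrite subKr mulrC.
Qed.

Lemma qmul1 : left_id (qpow 0) qmul.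
Proof.
move=> x; apply: qseriesP => e /=; rewrite /qmulf.
rewrite (@fsum_setT _ [set 0]); last by move=> a /mulz_neq0[]/=; case: (a =P 0).
by rewrite fsbig_set1 /= mul1r subr0.
Qed.

Lemma qmulDl : left_distributive qmul qadd.
Proof.
move=> x y z; apply: qseriesP => e /=; rewrite /qmulf.
have [mz Hz] := qseries_bounded z.
pose A := [set a | a <= e - mz /\ x a != 0].
pose B := [set a | a <= e - mz /\ y a != 0].
have fin : finite_set (A `|` B).
  by rewrite finite_setU; split; exact: qseries_finite.
have bd a : z (e - a) != 0 -> a <= e - mz.
  by move=> /Hz; rewrite lerBrDr addrC -lerBrDr.
rewrite !(@fsum_setT _ (A `|` B)).
- by rewrite -fsbig_split //=; apply: eq_fsbigr => a _; rewrite mulrDl.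
- by move=> a /mulz_neq0[ya /bd ?]; right.
- by move=> a /mulz_neq0[xa /bd ?]; left.
- move=> a /mulz_neq0[xya /bd ?]; have [x0|xa] := eqVneq (x a) 0; last by left.
  by right; split => //; move: xya; rewrite /= x0 add0r.
Qed.

Lemma qmulA : associative qmul.
Proof.
move=> x y z; apply/esym/qseriesP => e /=.
have [mx Hx] := qseries_bounded x; have [my Hy] := qseries_bounded y.
have [mz Hz] := qseries_bounded z.
pose A := [set a | a <= e - my - mz /\ x a != 0].
pose B := [set b | b <= e - mx - mz /\ y b != 0].
pose C := [set a + b | a in A & b in B].
have finA : finite_set A by exact: qseries_finite.
have finC : finite_set C by apply: finite_image2 => //; exact: qseries_finite.
have bdA a b : y b != 0 -> z (e - (a + b)) != 0 -> a <= e - my - mz.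
  by move=> /Hy yb /Hz; lra.
have bdB a b : x a != 0 -> z (e - (a + b)) != 0 -> b <= e - mx - mz.
  by move=> /Hx xa /Hz; lra.
have memC a c : x a != 0 -> y (c - a) != 0 -> z (e - c) != 0 ->
    A a /\ C c.
  move=> xa yc zc; have ac : a + (c - a) = c by rewrite addrC subrK.
  have Aa : A a by split => //; apply: bdA yc _; rewrite ac.
  split => //; exists a => //; exists (c - a) => //; split => //.
  by apply: bdB xa _; rewrite ac.
transitivity (\sum_(c \in C) \sum_(a \in A) x a * y (c - a) * z (e - c)).
  rewrite {1}/qmulf (@fsum_setT _ C); last first.
    by move=> c /mulz_neq0[/qmulf_neq0[a [xa ya]] zc]; case: (memC a c).
  apply: eq_fsbigr => c _ /=; rewrite /qmulf mulr_fsuml (@fsum_setT _ A) // => a.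
  by move=> /mulz_neq0[/mulz_neq0[xa ya] zc]; case: (memC a c).
rewrite exchange_fsbig // {1}/qmulf (@fsum_setT _ A); last first.
  move=> a /mulz_neq0[xa /qmulf_neq0[b [yb zb]]]; split => //.
  by apply: bdA yb _; rewrite opprD addrA.
apply: eq_fsbigr => a _ /=; rewrite /qmulf mulr_fsumr.
rewrite [RHS](@reindex_fsbigT _ _ _ _ _ (fun c : rat => c - a)); last first.
  by exists (fun b : rat => b + a) => b /=; rewrite ?addrK ?subrK.
rewrite [RHS](@fsum_setT _ C).
  by apply: eq_fsbigr => c _; rewrite mulrA opprB addrA subrK.
move=> c /mulz_neq0[xa /mulz_neq0[yc]]; rewrite opprB addrA subrK => zc.
by case: (memC a c).
Qed.

Lemma qone_neq0 : qpow 0 != 0 :> qseries.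
Proof. by apply/eqP => /(congr1 (fun x : qseries => x 0)). Qed.

HB.instance Definition _ :=
  GRing.Zmodule_isComNzRing.Build qseries qmulA qmulC qmul1 qmulDl qone_neq0.

(* [x^-1] is the inverse of [x] whenever [x] has one. *)
Definition qunit : pred qseries := fun x => `[< exists y, y * x = 1 >].
Definition qinv x : qseries :=
  if pselect (exists y, y * x = 1) is left h then projT1 (cid h) else x.

Lemma qmulV : {in qunit, left_inverse 1 qinv *%R}.
Proof.
move=> x; rewrite inE /qinv => ux.
by case: pselect => // h; case: cid.
Qed.

Lemma qunitP x y : y * x = 1 -> qunit x.
Proof. by move=> yx; apply/asboolP; exists y. Qed.

Lemma qinv_out : {in [predC qunit], qinv =1 id}.
Proof. by move=> x; rewrite !inE /qinv => /asboolP; case: pselect. Qed.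

HB.instance Definition _ :=
  GRing.ComNzRing_hasMulInverse.Build qseries qmulV qunitP qinv_out.

End QSeriesRing.

(* Infinite sums are formed coefficientwise. The family must have only finitely
   many members with a nonzero coefficient below any given exponent; otherwise
   the sum is set to 0. *)
Definition qsummable (I : choiceType) (A : set I) (F : I -> qseries) :=
  forall c : rat, finite_set [set i | A i /\ exists2 a, a <= c & F i a != 0].

Lemma qsum_subproof (I : choiceType) (A : set I) (F : I -> qseries) :
  qsummable A F ->
  forall c, finite_set [set a | a <= c /\ \sum_(i \in A) F i a != 0].
Proof.
move=> sF c; apply: (@sub_finite_set _ _
  (\bigcup_(i in [set i | A i /\ exists2 a, a <= c & F i a != 0])
     [set a | a <= c /\ F i a != 0])); last first.
  by apply: bigcup_finite => // i _; exact: qseries_finite.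
move=> a [ac Fa]; suff [i [Ai Fia]] : exists i, A i /\ F i a != 0.
  by exists i => //=; split => //; exists a.
apply: contra_neqP Fa => /forallNP H; apply: fsbig1 => i Ai.
by apply: contra_notP (H i) => /eqP.
Qed.

Definition qsum (I : choiceType) (A : set I) (F : I -> qseries) : qseries :=
  if pselect (qsummable A F) is left h then QSeries (qsum_subproof h) else 0.

Notation "\qsum_ ( i '\in' A ) F" := (qsum A (fun i => F))
  (at level 41, F at level 41, i at level 50, A at level 60,
   format "'[' \qsum_ ( i  '\in'  A ) '/  '  F ']'") : ring_scope.

(* A sequence converges, in the topology for which the sums above are limits of
   partial sums, if and only if its successive differences are summable. *)
Definition qlim (u : nat -> qseries) : qseries :=
  u 0%N + \qsum_(n \in [set: nat]) (u n.+1 - u n).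

(* (q)_n and (q)_oo; [qpow e] is q^e. *)
Definition qpoch (n : nat) : qseries :=
  \prod_(1 <= i < n.+1) (1 - qpow i%:R).

Definition qpoch_inf : qseries := qlim qpoch.

Definition qdelta (x y : rat) : qseries := (x == y)%:R.

Section FermionicSums.
Variable N : nat.

(* The component indexed by [i : 'I_N.-1] is the (i+1)-st one. *)
Definition cartan : 'M[rat]_N.-1 :=
  \matrix_(i, j) ((i == j)%:R *+ 2 - (`|i - j|%N == 1%N)%:R).

(* [unitv 0] and [unitv N] are zero. *)
Definition unitv (l : nat) : 'cV[rat]_N.-1 := \col_i (i.+1 == l)%:R.

Definition nvec (n : {ffun 'I_N.-1 -> nat}) : 'cV[rat]_N.-1 :=
  \col_i (n i)%:R.

(* (C^-1 n)_1, written e_1^T C^-1 n so that it is 0 when N = 1. *)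
Definition cinv1 (n : {ffun 'I_N.-1 -> nat}) : rat :=
  ((unitv 1)^T *m invmx cartan *m nvec n) 0 0.

(* n^T C^-1 (n - e_l) *)
Definition cform (l : nat) (n : {ffun 'I_N.-1 -> nat}) : rat :=
  ((nvec n)^T *m invmx cartan *m (nvec n - unitv l)) 0 0.

(* (q)_(n_1) ... (q)_(n_(N-1)) *)
Definition qpochs (n : {ffun 'I_N.-1 -> nat}) : qseries :=
  \prod_i qpoch (n i).

Definition string_exponent (l : nat) : rat :=
  l%:R * (N%:R - l%:R) / (2 * N%:R * (N%:R + 2)).

(* The level N string function c^l_m. *)
Definition string_function (l : nat) (m : int) : qseries :=
  qpow (string_exponent l) / qpoch_inf *
  \qsum_(n \in [set n | (m%:~R + l%:R) / (2 * N%:R) + cinv1 n \is a Num.int])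
    (qpow (cform l n) / qpochs n).

(* x = y or x = - y modulo N *)
Definition eqpm_mod (x y : rat) : bool :=
  ((x - y) / N%:R \is a Num.int) || ((x + y) / N%:R \is a Num.int).

(* The normalized branching function of the coset (P, P')_N. The sum over
   0 <= m <= N/2 with m in l/2 + Z is indexed by i = 2m. *)
Definition branching (P P' R S : int) (l : nat) : qseries :=
  let mu (a j : int) : rat := a%:~R / 2 + (P' * j)%:~R in
  qpow (- string_exponent l) *
  \sum_(i < N.+1 | odd i == odd l)
    string_function l i *
    (\qsum_(j \in [set j : int | eqpm_mod (mu (R - S) j) (i%:R / 2)])
       qpow (j%:~R / N%:R * (j * P * P' + P' * R - P * S)%:~R)
     - \qsum_(j \in [set j : int | eqpm_mod (mu (R + S) j) (i%:R / 2)])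
       qpow (N%:R^-1 * ((j * P' + S) * (j * P + R))%:~R)).

End FermionicSums.

(* The L-th term of the sequence alpha^(k). *)
Definition alpha (p p' r b s k : int) (L : nat) : qseries :=
  let lam := `|b - s| in
  let pk := p + k * p' in
  let rk := r + k * b in
  let at_ (j h : int) : qseries :=
    qdelta L%:R ((j * p')%:~R - h%:~R / 2) in
  qdelta L%:R 0
  + \qsum_(j \in [set j : int | 1 <= j])
      (qpow (j * (j * p' * pk + p' * rk - s * pk))%:~R * at_ j (lam - b + s)
       + qpow (j * (j * p' * pk - p' * rk + s * pk))%:~R * at_ j (lam + b - s))
  - \qsum_(j \in [set j : int | 0 <= j])
      (qpow ((j * p' + s) * (j * pk + rk))%:~R * at_ j (lam - b - s))
  - \qsum_(j \in [set j : int | 1 <= j])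
      (qpow ((j * p' - s) * (j * pk - rk))%:~R * at_ j (lam + b + s)).

(* Main.v *)
(* The key point is that the fermionic form of the string functions satisfies
   c^l_m = c^l_{-m}, which is not visible on the sum. Let t range over the 0/1
   sequences of length N with l ones, and let (delta t)_i = t_i - t_{i+1}, so
   that (C^-1 delta t)_i = #{ones among the first i bits} - i l / N. A telescoping
   identity in the variables q^(-n_i) expands
   q^(n C^-1 (n - e_l)) / (q)_n as the sum over t of
   q^(n C^-1 n') / prod_i (q)_{min (n_i, n'_i)}, where n' = n - delta t >= 0.
   Each term is invariant under (n, t) |-> (reverse of n', reverse of t), and this
   involution negates the residue class m.
   Given the evenness and the 2N-periodicity of c^l in m, both sides of the
   theorem are the same pair of sums over j in Z: since
   2 L + lambda = |2 j p' + b -/+ s| on the support of alpha, the exponent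
   L (L + lambda) / N equals ((2 j p' + b -/+ s)^2 - (b - s)^2) / (4 N). *)
Require Import Defs.
From mathcomp Require Import all_boot all_order all_algebra.
From mathcomp Require Import boolp classical_sets functions cardinality fsbigop.
From mathcomp Require Import zify ring lra.

Set Implicit Arguments.
Unset Strict Implicit.
Unset Printing Implicit Defensive.

Import Order.TTheory GRing.Theory Num.Theory.
Local Open Scope classical_set_scope.
Local Open Scope ring_scope.

(** * Formal series and infinite sums *)

Lemma qaddE (x y : qseries) a : (x + y) a = x a + y a.
Proof. by []. Qed.

Lemma qoppE (x : qseries) a : (- x) a = - x a.
Proof. by []. Qed.

Lemma q0E a : (0 : qseries) a = 0.
Proof. by []. Qed.

Lemma q1E : 1 = qpow 0 :> qseries.
Proof. by []. Qed.

Lemma qpowE e a : qpow e a = (a == e)%:R.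
Proof. by []. Qed.

Lemma qmulE (x y : qseries) e :
  (x * y) e = \sum_(a \in [set: rat]) x a * y (e - a).
Proof. by []. Qed.

Lemma qmul_coef_neq0 (x y : qseries) e :
  (x * y) e != 0 -> exists a, x a != 0 /\ y (e - a) != 0.
Proof. exact: qmulf_neq0. Qed.

Lemma qpow_mulE c (y : qseries) e : (qpow c * y) e = y (e - c).
Proof.
rewrite qmulE (@fsum_setT _ [set c]) ?fsbig_set1 ?qpowE ?eqxx ?mul1r// => a.
by rewrite qpowE /=; case: (a =P c) => // _; rewrite mul0r eqxx.
Qed.

Lemma qpowD a b : qpow (a + b) = qpow a * qpow b.
Proof.
apply: qseriesP => e; rewrite qpow_mulE !qpowE.
by congr ((_ : bool)%:R); apply/eqP/eqP; lra.
Qed.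

Lemma qpow_prod (I : Type) (s : seq I) (P : pred I) (f : I -> rat) :
  qpow (\sum_(i <- s | P i) f i) = \prod_(i <- s | P i) qpow (f i).
Proof. by apply: (big_morph qpow qpowD). Qed.

Lemma qpowMn (c : rat) n : qpow (c * n%:R) = qpow c ^+ n.
Proof.
elim: n => [|n IH]; first by rewrite mulr0 expr0.
by rewrite exprS -IH -qpowD; congr qpow; rewrite -natr1; ring.
Qed.

(** Lower bounds on the order of a series; the zero series satisfies every such bound. These bounds
    are the means by which families are shown to be summable. *)
Definition qord_ge (e : rat) (x : qseries) := forall a, x a != 0 -> e <= a.

Lemma qord_geW e f x : f <= e -> qord_ge e x -> qord_ge f x.
Proof. by move=> fe ex a /ex; apply: le_trans. Qed.

Lemma qord_ge0 e : qord_ge e 0.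
Proof. by move=> a; rewrite q0E eqxx. Qed.

Lemma qord_ge_pow e : qord_ge e (qpow e).
Proof. by move=> a; rewrite qpowE; case: (a =P e) => [->|]. Qed.

Lemma qord_geM e f x y : qord_ge e x -> qord_ge f y -> qord_ge (e + f) (x * y).
Proof. by move=> ex fy a /qmul_coef_neq0[b [/ex eb /fy]]; lra. Qed.

Lemma qord_geM0 e x y : qord_ge e x -> qord_ge 0 y -> qord_ge e (x * y).
Proof. by move=> ex /(qord_geM ex); rewrite addr0. Qed.

Lemma qord_geD e x y : qord_ge e x -> qord_ge e y -> qord_ge e (x + y).
Proof.
move=> ex ey a; rewrite qaddE.
have [->|/ex//] := eqVneq (x a) 0.
by rewrite add0r => /ey.
Qed.

Lemma qord_geN e x : qord_ge e x -> qord_ge e (- x).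
Proof. by move=> ex a; rewrite qoppE oppr_eq0 => /ex. Qed.

Lemma qord_ge_prod (I : Type) (s : seq I) (P : pred I) (f : I -> qseries) :
  (forall i, P i -> qord_ge 0 (f i)) -> qord_ge 0 (\prod_(i <- s | P i) f i).
Proof.
move=> H; elim/big_ind: _ => //; first exact: qord_ge_pow.
by move=> x y; exact: qord_geM0.
Qed.

(** * Calculus of coefficientwise infinite sums *)

Section QSum.
Variable I : choiceType.
Implicit Types (A B : set I) (F G : I -> qseries) (a c e : rat).

Lemma qsum_coef A F a :
  qsummable A F -> qsum A F a = \sum_(i \in A) F i a.
Proof. by move=> sF; rewrite /qsum; case: pselect. Qed.

(** All coefficients up to the exponent [c] are computed over one index set [S]. Choosing [S] finite
    reduces identities between infinite sums to finite ones. *)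
Lemma qsum_coef_sub A F c (S : set I) : qsummable A F -> S `<=` A ->
    (forall i a, A i -> a <= c -> F i a != 0 -> S i) ->
  forall a, a <= c -> qsum A F a = \sum_(i \in S) F i a.
Proof.
move=> sF SA HS a ac; rewrite qsum_coef//; apply/esym/fsbig_widen => // i [Ai nS] /=.
by apply: contra_notP nS => /eqP; exact: HS ac.
Qed.

Lemma eq_qsum A F G : (forall i, A i -> F i = G i) -> qsum A F = qsum A G.
Proof.
move=> FG; have sE : qsummable A F <-> qsummable A G.
  by split=> sF c; apply: sub_finite_set (sF c) => i [Ai]; rewrite /= FG.
rewrite /qsum; case: pselect => sF; case: pselect => sG //; try by tauto.
apply: qseriesP => a /=; apply: eq_fsbigr => i; rewrite inE => Ai.
by rewrite FG.
Qed.

Lemma eq_qsummable A F G :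
  (forall i, A i -> F i = G i) -> qsummable A F -> qsummable A G.
Proof. by move=> FG sF c; apply: sub_finite_set (sF c) => i [Ai]; rewrite /= FG. Qed.

Lemma qsummable_order A F (e : I -> rat) :
    (forall i, A i -> qord_ge (e i) (F i)) ->
    (forall c, finite_set [set i | A i /\ e i <= c]) ->
  qsummable A F.
Proof.
move=> eF fin c; apply: sub_finite_set (fin c) => i [Ai [a ac Fa]].
by split => //; apply: le_trans ac; exact: eF Fa.
Qed.

Lemma qsummable_finite A F : finite_set [set i | A i /\ F i != 0] -> qsummable A F.
Proof.
move=> fin c; apply: sub_finite_set fin => i [Ai [a ac Fa]]; split => //.
by apply: contra_neq Fa => ->.
Qed.

Lemma sub_qsummable A B F : A `<=` B -> qsummable B F -> qsummable A F.
Proof. by move=> AB sF c; apply: sub_finite_set (sF c) => i [/AB]. Qed.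

Lemma qsummableD A F G :
  qsummable A F -> qsummable A G -> qsummable A (fun i => F i + G i).
Proof.
move=> sF sG c; apply: (@sub_finite_set _ _
    ([set i | A i /\ exists2 a, a <= c & F i a != 0] `|`
     [set i | A i /\ exists2 a, a <= c & G i a != 0])).
  move=> i [Ai [a ac]]; rewrite qaddE.
  have [F0|Fa] := eqVneq (F i a) 0; last by left; split => //; exists a.
  by rewrite F0 add0r; right; split => //; exists a.
by rewrite finite_setU; split; [exact: sF|exact: sG].
Qed.

Lemma qsumD A F G : qsummable A F -> qsummable A G ->
  qsum A (fun i => F i + G i) = qsum A F + qsum A G.
Proof.
move=> sF sG; apply: qseriesP => a.
set S := [set i | A i /\ exists2 b, b <= a & F i b != 0] `|`
         [set i | A i /\ exists2 b, b <= a & G i b != 0].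
have finS : finite_set S by rewrite finite_setU; split; [exact: sF|exact: sG].
have SA : S `<=` A by move=> i [[]|[]].
rewrite qaddE (@qsum_coef_sub A F a S)//; last first.
  by move=> i b Ai ba Fb; left; split => //; exists b.
rewrite (@qsum_coef_sub A G a S)//; last first.
  by move=> i b Ai ba Gb; right; split => //; exists b.
rewrite (@qsum_coef_sub A _ a S) ?fsbig_split//; first exact: qsummableD.
move=> i b Ai ba; rewrite qaddE; have [F0|Fb _] := eqVneq (F i b) 0.
  by rewrite F0 add0r => Gb; right; split => //; exists b.
by left; split => //; exists b.
Qed.

Lemma qsummableM A F x : qsummable A F -> qsummable A (fun i => x * F i).
Proof.
move=> sF c; have [m Hm] := qseries_bounded x.
apply: sub_finite_set (sF (c - m)) => i [Ai [a ac]].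
move=> /qmul_coef_neq0[b [/Hm mb Fb]]; split => //; exists (a - b) => //.
by lra.
Qed.

Lemma qsumMr A F x : qsummable A F ->
  qsum A (fun i => x * F i) = x * qsum A F.
Proof.
move=> sF; apply: qseriesP => a; have [m Hm] := qseries_bounded x.
set S := [set i | A i /\ exists2 b, b <= a - m & F i b != 0].
have finS : finite_set S by exact: sF.
have SA : S `<=` A by move=> i [].
have HS i b : A i -> b <= a - m -> F i b != 0 -> S i by move=> Ai bm Fb; split => //; exists b.
(* Since [S] is finite, the series [F i] with [i] in [S] have a common lower bound [mF] on their
   exponents. Only exponents of [x] in the finite set [T] then contribute at [a], and the two sums
   can be exchanged. *)
have [mF HmF] : exists mF, forall i b, S i -> F i b != 0 -> mF <= b.
  have /finite_seqP[s Ss] := finS.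
  exists (\big[Order.min/0]_(i <- s) projT1 (cid (qseries_bounded (F i)))) => i b Si Fb.
  apply: le_trans (projT2 (cid (qseries_bounded (F i))) b Fb).
  by apply: ge_bigmin_seq => //; have : [set` s] i by rewrite -Ss.
set T := [set b | b <= a - mF /\ x b != 0].
have finT : finite_set T by exact: qseries_finite.
rewrite (@qsum_coef_sub A _ a S) //; last first.
- move=> i b Ai ba /qmul_coef_neq0[d [/Hm md Fd]]; apply: HS Fd => //; lra.
- exact: qsummableM.
transitivity (\sum_(i \in S) \sum_(b \in T) x b * F i (a - b)).
  apply: eq_fsbigr => i; rewrite inE => Si; rewrite qmulE; apply: fsum_setT.
  move=> b /mulz_neq0[xb Fb]; split => //; have := HmF _ _ Si Fb; lra.
rewrite exchange_fsbig// qmulE.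
rewrite (@fsum_setT _ T); last first.
  move=> b /mulz_neq0[xb]; rewrite qsum_coef// => H; split => //.
  have [i [Ai Fi]] : exists i, A i /\ F i (a - b) != 0.
    apply: contra_neqP H => /forallNP H; apply: fsbig1 => i Ai.
    by apply: contra_notP (H i) => /eqP.
  have Si : S i by apply: HS Fi => //; have := Hm _ xb; lra.
  by have := HmF _ _ Si Fi; lra.
apply: eq_fsbigr => b; rewrite inE => -[_ xb].
rewrite (@qsum_coef_sub A F (a - m) S)// ?mulr_fsumr//.
by have := Hm _ xb; lra.
Qed.

Lemma qsummableN A F : qsummable A F -> qsummable A (fun i => - F i).
Proof.
by move=> /(qsummableM (-1)); apply: eq_qsummable => i _; rewrite mulN1r.
Qed.

Lemma qsumB A F G : qsummable A F -> qsummable A G ->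
  qsum A (fun i => F i - G i) = qsum A F - qsum A G.
Proof.
move=> sF sG; rewrite qsumD//; last exact: qsummableN.
congr (_ + _); rewrite -mulN1r -qsumMr//; apply: eq_qsum => i _.
by rewrite mulN1r.
Qed.

(** Encodes the index set as a 0/1 factor, so that sums over different sets can be combined
    termwise. Summability of either family implies that of the other; in its absence both sums are 0
    by default. *)
Lemma qsum_cond A F : qsum A F = qsum setT (fun i => (`[< A i >])%:R * F i).
Proof.
have E i : ~ A i -> (`[< A i >])%:R * F i = 0.
  by move=> nA; rewrite asboolF ?mul0r.
have E' i : A i -> (`[< A i >])%:R * F i = F i.
  by move=> nA; rewrite asboolT ?mul1r.
have sE : qsummable A F <-> qsummable setT (fun i => (`[< A i >])%:R * F i).
  split=> sF c; apply: sub_finite_set (sF c) => i.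
    move=> [_ [a ac]]; have [Ai|/E->] := pselect (A i); last by rewrite eqxx.
    by rewrite E' => //; split => //; exists a.
  by move=> [Ai [a ac]]; rewrite -(E' _ Ai) => Fa; split => //; exists a.
rewrite /qsum; case: pselect => sF; case: pselect => sG //; try by tauto.
apply: qseriesP => a.
change (\sum_(i \in A) F i a =
  \sum_(i \in [set: I]) ((`[< A i >])%:R * F i : qseries) a).
rewrite -(@fsbig_widen _ _ _ _ A setT)//.
  by apply: eq_fsbigr => i; rewrite inE => Ai; rewrite (E' _ Ai).
by move=> i [_ nA]; rewrite /preimage /mkset (E _ nA).
Qed.

Lemma qsummable_cond A F :
  qsummable A F -> qsummable setT (fun i => (`[< A i >])%:R * F i).
Proof.
move=> sF c; apply: sub_finite_set (sF c) => i [_ [a ac]].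
have [Ai|nA] := pselect (A i); last by rewrite asboolF ?mul0r ?eqxx.
by rewrite asboolT ?mul1r// => Fa; split => //; exists a.
Qed.

Lemma qord_ge_qsum A F e :
  (forall i, A i -> qord_ge e (F i)) -> qord_ge e (qsum A F).
Proof.
move=> eF; rewrite /qsum; case: pselect => [sF|_]; last exact: qord_ge0.
move=> a /= Fa; have [i [Ai Fi]] : exists i, A i /\ F i a != 0.
  apply: contra_neqP Fa => /forallNP H; apply: fsbig1 => i Ai.
  by apply: contra_notP (H i) => /eqP.
exact: eF Fi.
Qed.

Lemma qsum_set1 i F : qsum [set i] F = F i.
Proof.
apply: qseriesP => a; rewrite qsum_coef ?fsbig_set1//.
by apply: qsummable_finite; apply: sub_finite_set (finite_set1 i) => j [].
Qed.

Lemma qsum_sum (J : Type) (s : seq J) (P : pred J) A (F : J -> I -> qseries) :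
    (forall j, P j -> qsummable A (F j)) ->
  qsummable A (fun i => \sum_(j <- s | P j) F j i) /\
  qsum A (fun i => \sum_(j <- s | P j) F j i) = \sum_(j <- s | P j) qsum A (F j).
Proof.
move=> sF; elim: s => [|j s [IH1 IH2]].
  under [fun i => _]funext do rewrite big_nil.
  rewrite big_nil; have s0 : qsummable A (fun=> 0).
    apply: qsummable_finite; apply: sub_finite_set (finite_set0 I) => i [_].
    by rewrite eqxx.
  by split => //; apply: qseriesP => a; rewrite qsum_coef// fsbig1.
under [fun i => _]funext do rewrite big_cons.
rewrite big_cons; case: ifP => // Pj; split.
  by apply: qsummableD => //; exact: sF.
by rewrite qsumD ?IH2//; exact: sF.
Qed.

Lemma qsum_setU A B F : A `&` B = set0 -> qsummable (A `|` B) F ->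
  qsum (A `|` B) F = qsum A F + qsum B F.
Proof.
move=> AB0 sF.
have sA : qsummable A F by apply: sub_qsummable sF => i; left.
have sB : qsummable B F by apply: sub_qsummable sF => i; right.
rewrite qsum_cond (qsum_cond A) (qsum_cond B) -qsumD; try exact: qsummable_cond.
apply: eq_qsum => i _; rewrite -mulrDl; congr (_ * _).
have [Ai|nA] := pselect (A i).
  have nB : ~ B i by move=> Bi; have : (A `&` B) i by []; rewrite AB0.
  by rewrite (asboolT Ai) (asboolF nB) asboolT ?addr0//; left.
rewrite (asboolF nA) add0r; congr (_%:R); congr nat_of_bool.
by apply: asbool_equiv_eq; split => [[]|] //; right.
Qed.

End QSum.

Lemma qsum_widen (I : choiceType) (A B : set I) (F : I -> qseries) :
  A `<=` B -> (forall i, B i -> ~ A i -> F i = 0) -> qsum A F = qsum B F.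
Proof.
move=> AB F0; rewrite qsum_cond (qsum_cond B); apply: eq_qsum => i _.
have [Ai|nA] := pselect (A i); first by rewrite !asboolT//; exact: AB.
have [Bi|nB] := pselect (B i); first by rewrite F0 ?mulr0.
by rewrite !asboolF.
Qed.

Lemma reindex_qsum (I J : choiceType) (h : I -> J) (A : set I) (B : set J)
    (F : J -> qseries) :
  set_bij A B h -> qsum B F = qsum A (fun i => F (h i)).
Proof.
move=> hb; have [hAB hinj hsurj] := hb.
have sE : qsummable B F <-> qsummable A (fun i => F (h i)).
  split=> sF c.
    set X := [set i | _]; suff : finite_set (h @` X).
      by rewrite (eq_finite_set (inj_card_eq _))// => i j /set_mem[Ai _] /set_mem[Aj _];
         apply: hinj; rewrite inE.
    by apply: sub_finite_set (sF c) => _ [i [Ai [a ac Fa]] <-]; split; [exact: hAB|exists a].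
  apply: sub_finite_set (finite_image h (sF c)) => j [Bj [a ac Fa]].
  by have [i Ai ij] := hsurj _ Bj; exists i; rewrite ?ij//; split => //; exists a; rewrite ?ij.
rewrite /qsum; case: pselect => sF; case: pselect => sG //; try by tauto.
by apply: qseriesP => a /=; exact: reindex_fsbig.
Qed.

(** Below any exponent only a finite set [S] of indices and its image under [f] contribute, which
    leaves a finite double sum whose order can be exchanged. It serves to regroup a sum over
    integers [j] by the position [L] of the term in alpha. *)
Lemma qsum_fibers (I J : choiceType) (f : J -> I) (A : set J) (G : J -> qseries) :
    qsummable A G ->
  qsummable setT (fun i => qsum [set j | A j /\ f j = i] G) /\
  qsum setT (fun i => qsum [set j | A j /\ f j = i] G) = qsum A G.
Proof.
move=> sG; pose B i := [set j | A j /\ f j = i].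
have sB i : qsummable (B i) G by apply: sub_qsummable sG => j [].
have sQ : qsummable setT (fun i => qsum (B i) G).
  move=> c; apply: sub_finite_set (finite_image f (sG c)) => i [_ [a ac]].
  rewrite (qsum_coef _ (sB i)) => H.
  have [j [[Aj fj] Gj]] : exists j, B i j /\ G j a != 0.
    apply: contra_neqP H => /forallNP H; apply: fsbig1 => j Bj.
    by apply: contra_notP (H j) => /eqP.
  by exists j => //; split => //; exists a.
split => //; apply: qseriesP => a.
set S := [set j | A j /\ exists2 b, b <= a & G j b != 0].
have finS : finite_set S by exact: sG.
have SA : S `<=` A by move=> j [].
rewrite (@qsum_coef_sub _ A G a S)//; last first.
  by move=> j b Aj ba Gj; split => //; exists b.
have finfS : finite_set (f @` S) by exact: finite_image.
rewrite (@qsum_coef_sub _ setT _ a (f @` S))//; last first.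
  move=> i b _ ba; rewrite (qsum_coef _ (sB i)) => H.
  have [j [[Aj fj] Gj]] : exists j, B i j /\ G j b != 0.
    apply: contra_neqP H => /forallNP H; apply: fsbig1 => j Bj.
    by apply: contra_notP (H j) => /eqP.
  by exists j => //; split => //; exists b.
transitivity (\sum_(i \in f @` S) \sum_(j \in S) (if f j == i then G j a else 0)).
  apply: eq_fsbigr => i _.
  rewrite (@qsum_coef_sub _ (B i) G a (S `&` [set j | f j = i]) (sB i))//.
  - rewrite fsbig_mkcondr; apply: eq_fsbigr => j _.
    by congr (if _ then _ else _); apply/idP/eqP; rewrite inE.
  - by move=> j [[Aj _] fj].
  - by move=> j b [Aj fj] ba Gj; split => //; split => //; exists b.
rewrite exchange_fsbig//; apply: eq_fsbigr => j; rewrite inE => Sj.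
rewrite -(@fsbig_widen _ _ _ _ [set f j])//.
- by rewrite fsbig_set1 eqxx.
- by move=> _ ->; exists j.
- by move=> i [_ nfj]; rewrite /preimage /mkset; case: eqP => // fji; case: nfj.
Qed.

(** * Inverses of the finite products (q)_n *)

Lemma finite_nat_le (e : nat -> rat) (c : rat) : (forall n, n%:R <= e n) ->
  finite_set [set n | e n <= c].
Proof.
move=> en; apply: (@sub_finite_set _ _ `I_(Num.truncn `|c|).+1); last exact: finite_II.
move=> n /= ec; rewrite ltnS.
have : n%:R <= `|c| :> rat by apply: le_trans (en n) (le_trans ec (ler_norm c)).
by rewrite truncn_ge_nat.
Qed.

Lemma qsummable_geom n : (0 < n)%N -> qsummable setT (fun k => qpow (n%:R * k%:R)).
Proof.
move=> n0; apply: (@qsummable_order _ _ _ (fun k => n%:R * k%:R)).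
  by move=> k _; exact: qord_ge_pow.
move=> c; apply: (@sub_finite_set _ _ [set k : nat | n%:R * k%:R <= c]); first by move=> k [].
apply: (@finite_nat_le (fun k => n%:R * k%:R)) => k.
by rewrite -natrM ler_nat leq_pmull.
Qed.

(** Splitting off [k = 0] and shifting the index gives g = 1 + q^n g for the geometric series g. *)
Lemma subr_qpowV n : (0 < n)%N ->
  qsum setT (fun k => qpow (n%:R * k%:R)) * (1 - qpow n%:R) = 1.
Proof.
move=> n0; have sg := qsummable_geom n0.
set g := qsum _ _; suff gE : g = 1 + qpow n%:R * g by rewrite mulrBr mulr1 mulrC; rewrite {1}gE; ring.
have TE : [set: nat] = [set 0%N] `|` [set k | (0 < k)%N].
  by apply/seteqP; split=> // -[|k] _; [left|right].
rewrite {1}/g TE qsum_setU -?TE//; last first.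
  by apply/seteqP; split=> // k [/= ->].
rewrite qsum_set1 mulr0; congr (_ + _); rewrite /g -qsumMr//.
rewrite (@reindex_qsum _ _ S setT)//; last first.
  split=> //; first by move=> i j _ _ [].
  by move=> [//|k] _; exists k.
by apply: eq_qsum => k _; rewrite -qpowD; congr qpow; rewrite -natr1; ring.
Qed.

Lemma subr_qpow_unit n : (0 < n)%N -> 1 - qpow n%:R \is a GRing.unit.
Proof.
move=> n0; apply/unitrP; exists (qsum setT (fun k => qpow (n%:R * k%:R))).
by rewrite [X in _ /\ X = _]mulrC subr_qpowV.
Qed.

Lemma subr_qpow_inv_order n : (0 < n)%N -> qord_ge 0 (1 - qpow n%:R)^-1.
Proof.
move=> n0; have -> : (1 - qpow n%:R)^-1 = qsum setT (fun k => qpow (n%:R * k%:R)).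
  by apply: (mulIr (subr_qpow_unit n0)); rewrite mulVr ?subr_qpow_unit ?subr_qpowV.
apply: qord_ge_qsum => k _; apply: qord_geW (@qord_ge_pow _).
by rewrite -natrM.
Qed.

Lemma qpochS n : qpoch n.+1 = qpoch n * (1 - qpow n.+1%:R).
Proof. by rewrite /qpoch big_nat_recr. Qed.

Lemma qpoch0 : qpoch 0 = 1.
Proof. by rewrite /qpoch big_geq. Qed.

Lemma qpoch_unit n : qpoch n \is a GRing.unit.
Proof.
elim: n => [|n IH]; first by rewrite qpoch0 unitr1.
by rewrite qpochS unitrM IH subr_qpow_unit.
Qed.

Lemma qpoch_inv_order n : qord_ge 0 (qpoch n)^-1.
Proof.
elim: n => [|n IH]; first by rewrite qpoch0 invr1; exact: qord_ge_pow.
rewrite qpochS invrM ?qpoch_unit ?subr_qpow_unit//.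
exact: qord_geM0 (subr_qpow_inv_order _) IH.
Qed.

(** Absorbs the factor 1 - q^(m_i) that the telescoping expansion produces at a descent. *)
Lemma qpoch_pred n : (0 < n)%N -> (1 - qpow n%:R) / qpoch n = (qpoch n.-1)^-1.
Proof.
case: n => // n _; rewrite qpochS invrM ?qpoch_unit ?subr_qpow_unit// mulrA.
by rewrite mulrV ?subr_qpow_unit// mul1r.
Qed.

(** * The inverse Cartan matrix *)

Lemma sum_delta_ord (R : pzRingType) n (f : nat -> R) k :
  \sum_(i < n) (i == k :> nat)%:R * f i = if (k < n)%N then f k else 0.
Proof.
case: ifP => kn.
  rewrite (bigD1 (Ordinal kn))//= eqxx mul1r big1 ?addr0// => i.
  by rewrite -val_eqE /= => /negbTE->; rewrite mul0r.
rewrite big1// => i _; case: (i =P k :> nat) => [ik|_]; last by rewrite mul0r.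
by rewrite -ik ltn_ord in kn.
Qed.

Section InverseCartan.
Variable n : nat.
Notation N := n.+1.

(** Natural-number indices make the boundary values at 0 and [N] available; they vanish for indices
    up to [N], in accordance with e_0 = e_N = 0. *)
Definition cinv (i j : nat) : rat := (minn i j)%:R - (i * j)%:R / N%:R.

(** The Cartan matrix acts as minus the discrete second difference; the zeros of [g] at 0 and [N]
    supply the missing neighbours of the two end nodes. *)
Lemma sum_cartan (g : nat -> rat) (i : 'I_n) : g 0%N = 0 -> g N = 0 ->
  \sum_(k < n) cartan N i k * g k.+1 = g i.+1 *+ 2 - g i - g i.+2.
Proof.
move=> g0 gN.
have E (k : 'I_n) : cartan N i k * g k.+1 =
    (k == i :> nat)%:R * (g k.+1 *+ 2) - (k.+1 == i :> nat)%:R * g k.+1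
    - (k == i.+1 :> nat)%:R * g k.+1.
  rewrite mxE -val_eqE /= eq_sym.
  have -> : (`|i - k|%N == 1%N)%:R = (k.+1 == i :> nat)%:R + (k == i.+1 :> nat)%:R :> rat.
    rewrite -natrD; congr (_%:R); lia.
  ring.
under eq_bigr do rewrite E.
rewrite !sumrB (@sum_delta_ord _ n (fun k => g k.+1 *+ 2)) ltn_ord.
rewrite (@sum_delta_ord _ n (fun k => g k.+1)).
congr (_ - _ - _).
  case: i {E} => -[|i] /= li; first by rewrite big1// => k _; rewrite mul0r.
  under eq_bigr do rewrite eqSS.
  by rewrite (@sum_delta_ord _ n (fun k => g k.+1)) ltnW.
case: ifP => // /negbT; rewrite -leqNgt => ni.
by have -> : i.+2 = N by move: (ltn_ord i) ni; lia.
Qed.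

Lemma invmx_cartan : invmx (cartan N) = \matrix_(i, j) cinv i.+1 j.+1.
Proof.
set X := matrix_of_fun _ _.
have CX : cartan N *m X = 1%:M.
  apply/matrixP => i j; rewrite !mxE.
  under eq_bigr do rewrite [X _ _]mxE.
  rewrite (@sum_cartan (fun k => cinv k j.+1)) /cinv.
  - rewrite -val_eqE /=; have N0 : N%:R != 0 :> rat by rewrite pnatr_eq0.
    have -> : (i == j :> nat)%:R =
        (minn i.+1 j.+1)%:R *+ 2 - (minn i j.+1)%:R - (minn i.+2 j.+1)%:R :> rat.
      rewrite -mulrnA -!natrB; last 2 first.
      + lia.
      + lia.
      congr (_%:R); lia.
    by rewrite !natrM -(natr1 i) -(natr1 i.+1) -(natr1 j) -(natr1 i); field; rewrite nat1r; exact: N0.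
  - by rewrite min0n mul0n mul0r subrr.
  - rewrite natrM mulrAC divff ?pnatr_eq0// mul1r.
    by have /minn_idPr-> : (j.+1 <= N)%N; rewrite ?subrr// ltnS ltnW// ltn_ord.
have [uC _] := mulmx1_unit CX.
by rewrite -[RHS](mulKmx uC) CX mulmx1.
Qed.

Lemma cinvC i j : cinv i j = cinv j i.
Proof. by rewrite /cinv minnC mulnC. Qed.

(** This is the reflection symmetry of the Dynkin diagram of A_(N-1). *)
Lemma cinv_rev (i j : nat) : (i <= N)%N -> (j <= N)%N ->
  cinv (N - i) (N - j) = cinv i j.
Proof.
move=> iN jN; rewrite /cinv.
have -> : minn (N - i) (N - j) = (N + minn i j - i - j)%N by lia.
have N0 : N%:R != 0 :> rat by rewrite pnatr_eq0.
rewrite !natrM !natrB ?natrD; try lia.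
by field; rewrite nat1r.
Qed.

(** For i <= j, counted from 1, the entry is i (N - j) / N, where i and N - j are positive integers.
    The bound makes the quadratic form dominate the square of the sum of the entries. *)
Lemma cinv_ge (i j : 'I_n) : N%:R^-1 <= cinv i.+1 j.+1.
Proof.
have N0 : 0 < N%:R :> rat by rewrite ltr0n.
wlog ij : i j / (i <= j)%N.
  by move=> H; have [/H//|/ltnW/H] := leqP i j; rewrite cinvC.
rewrite /cinv -[X in X <= _]mul1r ler_pdivrMr// mulrBl mulfVK ?gt_eqF//.
rewrite lerBrDr -natrM nat1r ler_nat.
have /minn_idPl-> : (i.+1 <= j.+1)%N by [].
have := ltn_ord j; nia.
Qed.

Definition bil (x y : 'I_n -> rat) : rat :=
  \sum_(i < n) x i * \sum_(j < n) cinv i.+1 j.+1 * y j.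

Lemma bilBr x y z : bil x (fun i => y i - z i) = bil x y - bil x z.
Proof.
rewrite /bil -sumrB; apply: eq_bigr => i _; rewrite -mulrBr -sumrB.
by congr (_ * _); apply: eq_bigr => j _; rewrite mulrBr.
Qed.

Lemma eq_bil x x' y y' : x =1 x' -> y =1 y' -> bil x y = bil x' y'.
Proof.
move=> xx yy; apply: eq_bigr => i _; rewrite xx; congr (_ * _).
by apply: eq_bigr => j _; rewrite yy.
Qed.

Lemma bilC x y : bil x y = bil y x.
Proof.
rewrite /bil; under eq_bigr do rewrite mulr_sumr.
rewrite exchange_big /=; apply: eq_bigr => i _; rewrite mulr_sumr.
by apply: eq_bigr => j _; rewrite cinvC; ring.
Qed.

Lemma bil_rev x y : bil (x \o @rev_ord n) (y \o @rev_ord n) = bil x y.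
Proof.
rewrite /bil (reindex_inj rev_ord_inj); apply: eq_bigr => i _ /=.
rewrite rev_ordK; congr (_ * _).
rewrite (reindex_inj rev_ord_inj); apply: eq_bigr => j _ /=.
rewrite rev_ordK; congr (_ * _); rewrite -cinv_rev; try lia.
by congr cinv; have := ltn_ord i; have := ltn_ord j; lia.
Qed.

Lemma cformE l (m : {ffun 'I_n -> nat}) : (l <= N)%N ->
  @cform N l m = bil (fun i => (m i)%:R) (fun i => (m i)%:R)
                - \sum_(i < n) (m i)%:R * cinv i.+1 l.
Proof.
move=> lN; rewrite /cform invmx_cartan mxE /bil.
under eq_bigr => j _.
  rewrite !mxE mulr_suml.
  under eq_bigr do rewrite !mxE.
  over.
rewrite exchange_big /= -sumrB; apply: eq_bigr => i _.
rewrite -mulrBr.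
under eq_bigr do rewrite -mulrA.
rewrite -mulr_sumr; congr (_ * _).
transitivity (\sum_(j < n) (cinv i.+1 j.+1 * (m j)%:R - (j.+1 == l)%:R * cinv i.+1 j.+1)).
  by apply: eq_bigr => j _; ring.
rewrite sumrB; congr (_ - _).
have N0 : N%:R != 0 :> rat by rewrite pnatr_eq0.
(* At [l = 0] and [l = N] the vector e_l is zero and [cinv] vanishes as well; for the other [l] the
   sum picks out a single entry. *)
case: l lN => [|l] lN.
  by rewrite /cinv minn0 muln0 mul0r subrr big1// => j _; rewrite mul0r.
under eq_bigr do rewrite eqSS.
rewrite (@sum_delta_ord _ n (fun j => cinv i.+1 j.+1)); case: ifP => // ln.
have -> : l = n by lia.
rewrite /cinv natrM mulfK//.
by have /minn_idPl-> : (i.+1 <= N)%N; rewrite ?subrr// ltnS ltnW.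
Qed.

Lemma cinv1E (m : {ffun 'I_n -> nat}) :
  @cinv1 N m = \sum_(i < n) (m i)%:R * (1 - i.+1%:R / N%:R).
Proof.
rewrite /cinv1 invmx_cartan mxE; apply: eq_bigr => j _.
rewrite !mxE mulrC; congr (_ * _).
under eq_bigr do rewrite !mxE eqSS.
rewrite (@sum_delta_ord _ n (fun i => cinv i.+1 j.+1)).
rewrite (leq_ltn_trans (leq0n j) (ltn_ord j)) /cinv mul1n.
by rewrite (minn_idPl _).
Qed.

End InverseCartan.

(** * The telescoping identity *)

Definition bit (t : seq bool) (i : nat) : bool := nth false t i.
Arguments bit : simpl never.
Definition ones (t : seq bool) (i : nat) : nat := count id (take i t).
Definition descent (t : seq bool) (i : nat) : bool := bit t i && ~~ bit t i.+1.
Definition ascent (t : seq bool) (i : nat) : bool := ~~ bit t i && bit t i.+1.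
(** The vector delta t: it is 1 at descents, -1 at ascents and 0 elsewhere. *)
Definition drift (t : seq bool) (i : nat) : rat := (bit t i)%:R - (bit t i.+1)%:R.

Lemma onesE t i : (i <= size t)%N -> ones t i = (\sum_(j < i) bit t j)%N.
Proof.
rewrite /ones; elim: i => [|i IH] it; first by rewrite take0 big_ord0.
rewrite (take_nth false)// -cats1 count_cat IH ?(ltnW it)// big_ord_recr /=.
by rewrite addn0.
Qed.

Lemma summation_by_parts (h x : nat -> rat) n :
  \sum_(j < n) h j.+1 * (x j - x j.+1) =
  \sum_(j < n.+1) x j * (h j.+1 - h j) + h 0%N * x 0%N - h n.+1 * x n.
Proof.
elim: n => [|n IH]; first by rewrite big_ord0 big_ord_recl big_ord0 /=; ring.
by rewrite big_ord_recr /= IH [in RHS]big_ord_recr /=; ring.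
Qed.

Lemma sum_bits n (t : n.+1.-tuple bool) :
  \sum_(j < n.+1) (bit t j)%:R = (count id t)%:R :> rat.
Proof.
by rewrite -natr_sum -onesE ?size_tuple// /ones take_oversize ?size_tuple.
Qed.

(** Summation by parts moves the difference onto the inverse Cartan matrix, where it becomes the
    indicator of j <= i minus (i + 1) / N. Both boundary terms vanish. *)
Lemma cinv_drift n (t : n.+1.-tuple bool) (i : 'I_n) :
  \sum_(j < n) cinv n i.+1 j.+1 * drift t j =
  (ones t i.+1)%:R - i.+1%:R * (count id t)%:R / n.+1%:R.
Proof.
rewrite (@summation_by_parts (cinv n i.+1) (fun j => (bit t j)%:R)).
have c0 : cinv n i.+1 0 = 0 by rewrite /cinv minn0 muln0 mul0r subrr.
have cN : cinv n i.+1 n.+1 = 0.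
  rewrite /cinv natrM mulfK ?pnatr_eq0//.
  by have /minn_idPl-> : (i.+1 <= n.+1)%N; rewrite ?subrr// ltnS ltnW.
rewrite c0 cN !mul0r addr0 subr0 -sum_bits.
have E (j : 'I_n.+1) : (bit t j)%:R * (cinv n i.+1 j.+1 - cinv n i.+1 j) =
   (bit t j)%:R * (j < i.+1)%:R - i.+1%:R / n.+1%:R * (bit t j)%:R :> rat.
  have -> : (j < i.+1)%N%:R = (minn i.+1 j.+1)%:R - (minn i.+1 j)%:R :> rat.
    by rewrite -natrB; [congr (_%:R)|]; lia.
  rewrite /cinv !natrM -(natr1 j); ring.
under eq_bigr do rewrite E.
rewrite sumrB -mulr_sumr; congr (_ - _); last by ring.
rewrite onesE ?size_tuple ?ltnS 1?ltnW// natr_sum.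
rewrite (big_ord_widen n.+1 (fun j => (bit t j)%:R)) ?ltnS 1?ltnW//.
rewrite [RHS]big_mkcond /=; apply: eq_bigr => j _.
by case: ifP; rewrite ?mulr1 ?mulr0.
Qed.

Lemma sum_drift n (t : n.+1.-tuple bool) :
  \sum_(j < n) j.+1%:R * drift t j = (count id t)%:R - n.+1%:R * (bit t n)%:R.
Proof.
rewrite (@summation_by_parts (fun j => j%:R) (fun j => (bit t j)%:R)).
rewrite mul0r addr0 -sum_bits; congr (_ - _); apply: eq_bigr => j _.
by rewrite -natr1; ring.
Qed.

Lemma big_tuple_rcons (R : nmodType) m (P : pred (seq bool)) (F : seq bool -> R) :
  \sum_(t : m.+1.-tuple bool | P t) F t =
  \sum_(t : m.-tuple bool | P (rcons t true)) F (rcons t true) +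
  \sum_(t : m.-tuple bool | P (rcons t false)) F (rcons t false).
Proof.
pose h (u : bool * m.-tuple bool) : m.+1.-tuple bool := [tuple of rcons u.2 u.1].
have hI : injective h.
  move=> [c t] [c' t'] /(congr1 val) /= /rcons_inj[tt cc].
  by congr pair => //; exact: val_inj.
have hB : bijective h.
  apply: (inj_card_bij hI).
  by rewrite card_tuple card_prod card_tuple card_bool expnS.
rewrite (reindex h) /=; last exact: onW_bij.
rewrite big_mkcond -(pair_big xpredT xpredT 
  (fun (c : bool) (t : m.-tuple bool) =>
     if P (rcons t c) then F (rcons t c) else 0)) /=.
by rewrite big_bool /= -!big_mkcond.
Qed.

Lemma bit_rcons n (t : n.-tuple bool) c : bit (rcons t c) n = c.
Proof. by rewrite /bit nth_rcons size_tuple ltnn eqxx. Qed.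

Lemma count_id_rcons t c : count id (rcons t c) = (count id t + c)%N.
Proof. by rewrite -cats1 count_cat /= addn0. Qed.

Section BitWeights.
Variables (R : comNzRingType) (w z : nat -> R).
Hypothesis wz : forall i, w i * z i = 1.

(** The identity is proved for arbitrary w_i with inverses z_i in a commutative ring, and applied
    with w_i = q^(-m_i) and z_i = q^(m_i). *)
Definition bit_weight n (t : seq bool) : R :=
  \prod_(i < n) (w i ^+ ones t i.+1 * (if descent t i then 1 - z i else 1)).

Lemma bit_weight_rcons n t c : size t = n.+1 ->
  bit_weight n.+1 (rcons t c) =
  bit_weight n t * (w n ^+ count id t * (if bit t n && ~~ c then 1 - z n else 1)).
Proof.
move=> st; rewrite /bit_weight big_ord_recr /=; congr (_ * _).
  apply: eq_bigr => i _; have iN := ltn_ord i.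
  rewrite /ones -cats1 takel_cat ?st ?ltnS 1?ltnW//.
  by rewrite /descent /bit !nth_cat st !ltnS iN ltnW.
rewrite /ones /descent /bit -cats1 takel_cat ?st// -st take_size.
by rewrite !nth_cat st ltnSn ltnn subnn.
Qed.

(** A final one creates no descent, so the only new factor is w_n to the number of ones before
    it. *)
Lemma sum_bit_weight_last n l :
  \sum_(t : n.+2.-tuple bool | (count id t == l.+1) && bit t n.+1) bit_weight n.+1 t
  = w n ^+ l * \sum_(t : n.+1.-tuple bool | count id t == l) bit_weight n t.
Proof.
rewrite (@big_tuple_rcons _ n.+1 (fun t => (count id t == l.+1) && bit t n.+1)).
rewrite [X in _ + X]big1 ?addr0.
  rewrite mulr_sumr; apply: eq_big => t.
    by rewrite count_id_rcons bit_rcons addn1 eqSS andbT.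
  rewrite count_id_rcons addn1 eqSS => /andP[/eqP ct _].
  by rewrite bit_weight_rcons ?size_tuple// ct andbF mulr1 mulrC.
by move=> t /andP[_]; rewrite bit_rcons.
Qed.

(** Split by the last bit. Appending a zero produces the factor 1 - z_n exactly when the preceding
    bit is one, whence the subtracted sum. *)
Lemma sum_bit_weight_rcons n l :
  \sum_(t : n.+2.-tuple bool | count id t == l) bit_weight n.+1 t
  = \sum_(t : n.+2.-tuple bool | (count id t == l) && bit t n.+1) bit_weight n.+1 t
  + w n ^+ l * (\sum_(t : n.+1.-tuple bool | count id t == l) bit_weight n t
     - z n * \sum_(t : n.+1.-tuple bool | (count id t == l) && bit t n) bit_weight n t).
Proof.
rewrite (bigID (fun t : n.+2.-tuple bool => bit t n.+1)) /=; congr (_ + _).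
rewrite (@big_tuple_rcons _ n.+1 (fun t => (count id t == l) && ~~ bit t n.+1)).
rewrite [X in X + _]big1 ?add0r; last first.
  by move=> t /andP[_]; rewrite bit_rcons.
rewrite [X in _ * (_ - _ * X)]big_mkcondr mulr_sumr -sumrB mulr_sumr.
apply: eq_big => t.
  by rewrite count_id_rcons bit_rcons addn0 andbT.
rewrite count_id_rcons addn0 => /andP[/eqP ct _].
rewrite bit_weight_rcons ?size_tuple// ct andbT.
by case: ifP => _; ring.
Qed.

Lemma big_tuple0 (P : pred (seq bool)) (F : seq bool -> R) :
  \sum_(t : 0.-tuple bool | P t) F t = if P [::] then F [::] else 0.
Proof.
rewrite big_mkcond (bigD1 [tuple]) //= big1 ?addr0// => t.
by rewrite (tuple0 t); case/negP; apply/eqP; exact: val_inj.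
Qed.

(** The induction needs the sum restricted to a final one as well. For l <= n its value for l + 1
    ones is that of the full sum for l ones. Because w^(l+1) z = w^l, these two contributions
    cancel, and w^(l+1) times the full sum for l + 1 ones remains. *)
Lemma bit_weight_sums n :
  (forall l, \sum_(t : n.+1.-tuple bool | count id t == l) bit_weight n t
    = if (l <= n.+1)%N then \prod_(i < n) w i ^+ minn i.+1 l else 0) /\
  (forall l, \sum_(t : n.+1.-tuple bool | (count id t == l.+1) && bit t n) bit_weight n t
    = if (l <= n)%N then \prod_(i < n) w i ^+ minn i.+1 l else 0).
Proof.
elim: n => [|n [IHS IHL]].
  have W0 t : bit_weight 0 t = 1 by rewrite /bit_weight big_ord0.
  split=> l.
    rewrite (@big_tuple_rcons _ 0 (fun t => count id t == l)).
    rewrite (@big_tuple0 (fun t => count id (rcons t true) == l)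
      (fun t => bit_weight 0 (rcons t true))).
    rewrite (@big_tuple0 (fun t => count id (rcons t false) == l)
      (fun t => bit_weight 0 (rcons t false))).
    by rewrite !W0 !big_ord0; case: l => [|[|l]] /=; rewrite ?add0r ?addr0.
  rewrite (@big_tuple_rcons _ 0 (fun t => (count id t == l.+1) && bit t 0)).
  rewrite (@big_tuple0 (fun t => (count id (rcons t true) == l.+1) && bit (rcons t true) 0)
      (fun t => bit_weight 0 (rcons t true))).
  rewrite (@big_tuple0 (fun t => (count id (rcons t false) == l.+1) && bit (rcons t false) 0)
      (fun t => bit_weight 0 (rcons t false))).
  by rewrite !W0 !big_ord0; case: l => [|l] /=; rewrite ?add0r ?addr0.
have L l : \sum_(t : n.+2.-tuple bool | (count id t == l.+1) && bit t n.+1)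
      bit_weight n.+1 t
    = if (l <= n.+1)%N then \prod_(i < n.+1) w i ^+ minn i.+1 l else 0.
  rewrite sum_bit_weight_last IHS; case: ifP => ln; last by rewrite mulr0.
  by rewrite big_ord_recr /= mulrC (minn_idPr ln).
split=> // -[|l]; rewrite sum_bit_weight_rcons.
  rewrite big1 ?add0r; last first.
    move=> t /andP[ct bt]; exfalso; move: ct.
    rewrite -leqn0 leqNgt -has_count; move/negP; apply; apply/hasP; exists true => //.
    by rewrite -bt mem_nth ?size_tuple.
  rewrite IHS [X in _ - z n * X]big1; last first.
    move=> t /andP[ct bt]; exfalso; move: ct.
    rewrite -leqn0 leqNgt -has_count; move/negP; apply; apply/hasP; exists true => //.
    by rewrite -bt mem_nth ?size_tuple.
  rewrite mulr0 subr0 mul1r /=.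
  by rewrite big_ord_recr /= minn0 mulr1.
rewrite L IHS IHL mulrBr mulrA.
have -> : w n ^+ l.+1 * z n = w n ^+ l by rewrite exprSr -mulrA wz mulr1.
rewrite [in RHS]big_ord_recr /= [X in X + _]/=.
have [ln|nl] := leqP l n.
  rewrite (leqW ln) !ltnS (leqW ln) ln big_ord_recr /=.
  have /minn_idPr-> : (l <= n.+1)%N by exact: leqW.
  have /minn_idPr-> : (l.+1 <= n.+1)%N by [].
  ring.
(* For l > n the sequences ending in zero contribute nothing. The only nonzero case is l = n + 1,
   where all n + 2 bits are ones. *)
rewrite !ltnS (leqNgt l n) nl /= !mulr0 subrr addr0.
case: ifP => // ln1.
have {ln1 nl L IHS IHL} -> : l = n.+1 by lia.
rewrite big_ord_recr /=; congr (_ * _); last by congr (_ ^+ _); lia.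
by apply: eq_bigr => i _; congr (_ ^+ _); have := ltn_ord i; lia.
Qed.

End BitWeights.

(** * Evenness of the string functions *)

Section FermionicSymmetry.
Variable n : nat.
Notation N := n.+1.
Implicit Types (m : {ffun 'I_n -> nat}) (t : N.-tuple bool).

Definition rvec m (i : 'I_n) : rat := (m i)%:R.

Definition bit_exponent t m : rat :=
  bil (rvec m) (fun i => rvec m i - drift t i).

(** The factor 1 - q^(m_i) at a descent lowers (q)_(m_i) to (q)_(m_i - 1), so the denominators
    become (q)_(min (m_i, n'_i)) with n' = m - delta t. It also makes the term vanish when some n'_i
    would be negative. *)
Definition bit_term t m : qseries :=
  qpow (bit_exponent t m) *
  \prod_(i < n) ((if descent t i then 1 - qpow (m i)%:R else 1) / qpoch (m i)).

Lemma bit_exponentE t m : bit_exponent t m =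
  bil (rvec m) (rvec m) -
  \sum_(i < n) rvec m i * ((ones t i.+1)%:R - i.+1%:R * (count id t)%:R / N%:R).
Proof.
rewrite /bit_exponent bilBr; congr (_ - _); apply: eq_bigr => i _.
by rewrite cinv_drift.
Qed.

Lemma qpochsV m : (@qpochs N m)^-1 = \prod_(i < n) (qpoch (m i))^-1.
Proof.
pose P (x y : qseries) := x \is a GRing.unit /\ x^-1 = y.
suff [] : P (@qpochs N m) (\prod_(i < n) (qpoch (m i))^-1) by [].
apply: (big_rec2 P); first by rewrite /P invr1 unitr1.
by move=> i y x _ [ux <-]; rewrite /P unitrM ux qpoch_unit invrM ?qpoch_unit// mulrC.
Qed.

(** The exponents on the two sides differ only in the power of q^(-m_i): min (i + 1, l) on the left,
    the number of ones among the first i + 1 bits on the right. [expE] isolates these powers, and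
    [bit_weight_sums] performs the sum over [t]. *)
Lemma cform_bit_terms l m : (l <= N)%N ->
  qpow (@cform N l m) / @qpochs N m =
  \sum_(t : N.-tuple bool | count id t == l) bit_term t m.
Proof.
(* The weights in [bit_weight_sums] are indexed by all naturals, so [m] is extended by 0. *)
move=> lN; pose f k : rat := if insub k is Some i then rvec m i else 0.
have fE (i : 'I_n) : f i = rvec m i by rewrite /f valK.
pose K := bil (rvec m) (rvec m) + \sum_(i < n) rvec m i * (i.+1%:R * l%:R / N%:R).
have wz k : qpow (- f k) * qpow (f k) = 1 by rewrite -qpowD addNr.
have expE (c : 'I_n -> nat) :
    qpow (bil (rvec m) (rvec m) -
      \sum_(i < n) rvec m i * ((c i)%:R - i.+1%:R * l%:R / N%:R)) =
    qpow K * \prod_(i < n) qpow (- f i) ^+ c i.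
  rewrite -[in RHS](eq_bigr _ (fun (i : 'I_n) _ => qpowMn _ _)) -qpow_prod -qpowD.
  congr qpow; rewrite /K -addrA; congr (_ + _).
  rewrite -sumrN -big_split; apply: eq_bigr => i _ /=; rewrite fE; ring.
rewrite (@cformE n)//.
have -> : \sum_(i < n) (m i)%:R * cinv n i.+1 l =
    \sum_(i < n) rvec m i * ((minn i.+1 l)%:R - i.+1%:R * l%:R / N%:R).
  by apply: eq_bigr => i _; rewrite /cinv natrM.
rewrite expE -mulrA.
have := (bit_weight_sums wz n).1 l; rewrite lN => <-.
rewrite mulr_suml mulr_sumr; apply: eq_bigr => t /eqP ct.
rewrite /bit_term bit_exponentE ct expE -mulrA; congr (_ * _).
rewrite /bit_weight big_split /= -mulrA; congr (_ * _).
rewrite big_split /=; congr (_ * _).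
  by apply: eq_bigr => i _; rewrite fE.
by rewrite qpochsV.
Qed.

(** Says that n' = m - delta t has no negative entry, since [drift] is positive only at descents,
    where it is 1. *)
Definition admissible t m := forall i : 'I_n, descent t i -> (0 < m i)%N.

Lemma bit_term0 t m : ~ admissible t m -> bit_term t m = 0.
Proof.
move=> /existsNP[i /not_implyP[di /negP]]; rewrite -leqNgt leqn0 => /eqP mi.
by rewrite /bit_term (bigD1 i)//= di mi subrr mul0r mul0r mulr0.
Qed.

Lemma bit_termE t m : admissible t m ->
  bit_term t m = qpow (bit_exponent t m) * \prod_(i < n) (qpoch (m i - descent t i))^-1.
Proof.
move=> adm; congr (_ * _); apply: eq_bigr => i _.
case: ifP => di; last by rewrite subn0 mul1r.
by rewrite qpoch_pred ?adm// subn1.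
Qed.

(** The reverse of n' = m - delta t. For admissible pairs the truncated subtraction is a true
    one. *)
Definition drift_rev t m : {ffun 'I_n -> nat} :=
  [ffun i => (m (rev_ord i) - descent t (rev_ord i) + ascent t (rev_ord i))%N].

Lemma bit_rev t i : (i <= n)%N -> bit (rev t) i = bit t (n - i).
Proof. by move=> iN; rewrite /bit nth_rev size_tuple ?subSS. Qed.

Lemma descent_rev t (i : 'I_n) : descent (rev t) i = ascent t (rev_ord i).
Proof.
have := ltn_ord i => iN; rewrite /descent /ascent !bit_rev ?(ltnW iN)//= andbC.
by congr (_ && bit _ _); lia.
Qed.

Lemma ascent_rev t (i : 'I_n) : ascent (rev t) i = descent t (rev_ord i).
Proof.
have := ltn_ord i => iN; rewrite /descent /ascent !bit_rev ?(ltnW iN)//= andbC.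
by congr (_ && ~~ bit _ _); lia.
Qed.

Lemma drift_rev_tuple t (i : 'I_n) : drift (rev t) i = - drift t (rev_ord i).
Proof.
have := ltn_ord i => iN; rewrite /drift !bit_rev ?(ltnW iN)//= opprB.
by congr ((bit _ _)%:R - _); lia.
Qed.

Lemma rvec_drift_rev t m i : admissible t m ->
  rvec (drift_rev t m) i = rvec m (rev_ord i) - drift t (rev_ord i).
Proof.
move=> /(_ (rev_ord i)); rewrite /rvec ffunE /descent /ascent /drift.
move: (m _) => k.
case: (bit t (rev_ord i)); case: (bit t (rev_ord i).+1) => /= H.
- by rewrite subn0 addn0; ring.
- by rewrite addn0 natrB ?H//; ring.
- by rewrite subn0 natrD; ring.
- by rewrite subn0 addn0; ring.
Qed.

Lemma admissible_drift_rev t m : admissible t m ->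
  admissible [tuple of rev t] (drift_rev t m).
Proof.
move=> adm i; rewrite descent_rev => ai.
by rewrite ffunE ai addn1.
Qed.

Lemma drift_revK t m : admissible t m ->
  drift_rev [tuple of rev t] (drift_rev t m) = m.
Proof.
move=> adm; apply/ffunP => i; rewrite !ffunE !rev_ordK.
rewrite descent_rev ascent_rev rev_ordK.
have := adm i; rewrite /descent /ascent.
case: (bit t i); case: (bit t i.+1) => /= H; rewrite ?subn0 ?addn0//.
  by rewrite subn1 addn1 prednK// H.
by rewrite addn1 subn1.
Qed.

(** The exponent m C^-1 n' is symmetric in m and n' and invariant under reversal. The denominators
    depend only on min (m_i, n'_i), which is m_i minus the indicator of a descent. *)
Lemma bit_term_drift_rev t m : admissible t m ->
  bit_term [tuple of rev t] (drift_rev t m) = bit_term t m.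
Proof.
move=> adm; rewrite !bit_termE//; last exact: admissible_drift_rev.
congr (_ * _).
  congr qpow; rewrite /bit_exponent.
  rewrite [RHS]bilC -[RHS]bil_rev; apply: eq_bil => i /=; rewrite rvec_drift_rev//.
  by rewrite drift_rev_tuple opprK subrK.
rewrite [RHS](reindex_inj rev_ord_inj); apply: eq_bigr => i _.
by rewrite ffunE descent_rev addnK.
Qed.

(** With i counted from 1, reversal turns the weight 1 - i/N into i/N. The two values therefore add
    up to the sum of the m_i minus the sum of i (delta t)_i / N, and by [sum_drift] the sum of i
    (delta t)_i is the number of ones modulo N. *)
Lemma cinv1_drift_rev t m : admissible t m ->
  @cinv1 N m + @cinv1 N (drift_rev t m) + (count id t)%:R / N%:R \is a Num.int.
Proof.
move=> adm; rewrite !cinv1E [X in _ + X + _](reindex_inj rev_ord_inj) /= -big_split /=.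
have N0 : N%:R != 0 :> rat by rewrite pnatr_eq0.
have E (i : 'I_n) : (m i)%:R * (1 - i.+1%:R / N%:R) +
    (drift_rev t m (rev_ord i))%:R * (1 - (rev_ord i).+1%:R / N%:R) =
    (m i)%:R - (i.+1%:R * drift t i) / N%:R :> rat.
  have := rvec_drift_rev (rev_ord i) adm; rewrite /rvec rev_ordK => ->.
  have -> : (rev_ord i).+1%:R = N%:R - i.+1%:R :> rat.
    have iN := ltn_ord i; rewrite -natrB; last by lia.
    by congr (_%:R) => /=; lia.
  by field; rewrite nat1r.
under eq_bigr do rewrite E.
rewrite sumrB -mulr_suml sum_drift -natr_sum.
have -> : forall x y z : rat, x - (y - N%:R * z) / N%:R + y / N%:R = x + z.
  by move=> x y z; field; rewrite nat1r.
by rewrite -natrD natr_int.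
Qed.

End FermionicSymmetry.

(** * Summability, periodicity and evenness of the fermionic sum *)

Lemma finite_ffun_le n (c : nat) :
  finite_set [set m : {ffun 'I_n -> nat} | forall i, (m i <= c)%N].
Proof.
apply: (@sub_finite_set _ _
  ((fun f : {ffun 'I_n -> 'I_c.+1} => [ffun i => nat_of_ord (f i)]) @` setT)).
  move=> m /= mc; exists [ffun i => inord (m i)] => //.
  by apply/ffunP => i; rewrite !ffunE inordK// ltnS.
by apply: finite_image; exact: finite_finset.
Qed.

Section FermionicSum.
Variable n : nat.
Notation N := n.+1.
Implicit Types (m : {ffun 'I_n -> nat}) (t : N.-tuple bool).

Definition fermi (l : nat) (a : int) : qseries :=
  \qsum_(m \in [set m | (a%:~R + l%:R) / (2 * N%:R) + @cinv1 N m \is a Num.int])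
    (qpow (@cform N l m) / @qpochs N m).

(** Minus the minimum of s^2 / N - (N + 1) s, attained at s = N (N + 1) / 2. *)
Definition exponent_gap : rat := N%:R * (N%:R + 1) ^+ 2 / 4.

(** With s the sum of the m_i, the quadratic part is at least s^2 / N by [cinv_ge] and the linear
    part at most s N; then the square is completed. The bound leaves finitely many [m] below any
    exponent. *)
Lemma bit_exponent_ge t m :
  (\sum_(i < n) m i)%N%:R - exponent_gap <= bit_exponent t m.
Proof.
have N0 : 0 < N%:R :> rat by rewrite ltr0n.
set s : rat := (\sum_(i < n) m i)%N%:R.
have sE : s = \sum_(i < n) rvec m i by rewrite /s natr_sum.
have quad : s ^+ 2 / N%:R <= bil (rvec m) (rvec m).
  rewrite expr2 -mulrA [X in X * _]sE mulr_suml; apply: ler_sum => i _.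
  rewrite ler_wpM2l ?ler0n// mulrC sE mulr_sumr; apply: ler_sum => j _.
  by rewrite ler_wpM2r ?ler0n// cinv_ge.
have lin : \sum_(i < n) rvec m i * ((ones t i.+1)%:R - i.+1%:R * (count id t)%:R / N%:R)
    <= s * N%:R.
  rewrite sE mulr_suml; apply: ler_sum => i _; rewrite ler_wpM2l ?ler0n//.
  have : 0 <= i.+1%:R * (count id t)%:R / N%:R :> rat.
    by rewrite divr_ge0// ?mulr_ge0.
  have : (ones t i.+1)%:R <= N%:R :> rat.
    rewrite ler_nat; apply: leq_trans (count_size _ _) _.
    by rewrite size_take size_tuple; have := ltn_ord i; case: ifP; lia.
  by move=> h1 h2; rewrite lerBlDr (le_trans h1)// lerDl.
rewrite bit_exponentE.
have : 0 <= (s - N%:R * (N%:R + 1) / 2) ^+ 2 / N%:R.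
  by rewrite divr_ge0 ?sqr_ge0// ltW.
have -> : (s - N%:R * (N%:R + 1) / 2) ^+ 2 / N%:R =
    s ^+ 2 / N%:R - s * N%:R - s + exponent_gap.
  by rewrite /exponent_gap; field; rewrite nat1r gt_eqF.
have key (b c q r u g : rat) :
    q <= b -> c <= r -> 0 <= q - r - u + g -> u - g <= b - c by lra.
exact: key quad lin.
Qed.

Lemma bit_term_order t m : qord_ge (bit_exponent t m) (bit_term t m).
Proof.
apply: qord_geM0; first exact: qord_ge_pow.
apply: qord_ge_prod => i _; apply: qord_geM0; last exact: qpoch_inv_order.
case: ifP => _; last exact: qord_ge_pow.
apply: qord_geD; first exact: qord_ge_pow.
by apply: qord_geN; apply: qord_geW (@qord_ge_pow _).
Qed.

Lemma bit_term_summable A t : qsummable A (bit_term t).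
Proof.
apply: (@qsummable_order _ _ _ (bit_exponent t)).
  by move=> m _; exact: bit_term_order.
move=> c; pose b := Num.truncn `|c + exponent_gap|.
apply: sub_finite_set (@finite_ffun_le n b) => m [_ mc] i.
apply: (@leq_trans (\sum_(i < n) m i)%N); first by rewrite (bigD1 i)//= leq_addr.
rewrite /b truncn_ge_nat//; apply: le_trans (ler_norm _).
by have := bit_exponent_ge t m; lra.
Qed.

Lemma fermi_bit_sums l a : (l <= N)%N ->
  fermi l a = \sum_(t : N.-tuple bool | count id t == l)
    qsum [set m | (a%:~R + l%:R) / (2 * N%:R) + @cinv1 N m \is a Num.int] (bit_term t).
Proof.
move=> lN; rewrite /fermi.
have [_ <-] := @qsum_sum _ _ (index_enum _) (fun t : N.-tuple bool => count id t == l)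
  [set m | (a%:~R + l%:R) / (2 * N%:R) + @cinv1 N m \is a Num.int] (fun t => bit_term t)
  (fun t _ => @bit_term_summable _ t).
by apply: eq_qsum => m _; rewrite cform_bit_terms.
Qed.

Lemma fermi_order l a : (l <= N)%N -> qord_ge (- exponent_gap) (fermi l a).
Proof.
move=> lN; rewrite fermi_bit_sums//; elim/big_ind: _ => [|x y|t _].
- exact: qord_ge0.
- exact: qord_geD.
apply: qord_ge_qsum => m _; apply: qord_geW (@bit_term_order t m).
apply: le_trans (bit_exponent_ge t m).
by have : 0 <= (\sum_(i < n) m i)%N%:R :> rat by []; lra.
Qed.

Lemma fermi_periodic l a (k : int) : fermi l (a + k * N%:R *+ 2) = fermi l a.
Proof.
rewrite /fermi; congr qsum; apply/seteqP.
have E m : ((a + k * N%:R *+ 2)%:~R + l%:R) / (2 * N%:R) + @cinv1 N m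
   = (a%:~R + l%:R) / (2 * N%:R) + @cinv1 N m + k%:~R.
  rewrite intrD rmorphMn rmorphM rmorph_nat /=.
  by field; rewrite nat1r pnatr_eq0.
split=> m /=; first by rewrite E rpredDr ?intr_int.
by move=> H; rewrite E rpredDr ?intr_int.
Qed.

(* The involution (m, t) |-> (drift_rev t m, rev t) preserves the terms and
   negates the residue class. *)
Lemma fermi_even l a : (l <= N)%N -> fermi l (- a) = fermi l a.
Proof.
move=> lN; rewrite !fermi_bit_sums//.
have N0 : N%:R != 0 :> rat by rewrite pnatr_eq0.
pose C a := [set m | (a%:~R + l%:R) / (2 * N%:R) + @cinv1 N m \is a Num.int].
pose revt t : N.-tuple bool := [tuple of rev t].
have revtK t : revt (revt t) = t by apply: val_inj; exact: revK.
rewrite (reindex_inj (can_inj revtK)); apply: eq_big => [t|t /eqP ct].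
  by rewrite /= count_rev.
rewrite /= count_rev in ct.
(* [drift_rev] is inverted by [drift_revK] on admissible vectors; the terms of all others vanish and
   are dropped first. *)
have adm0 (t' : N.-tuple bool) b : qsum (C b) (bit_term t') =
    qsum (C b `&` [set m | admissible t' m]) (bit_term t').
  apply/esym/qsum_widen; first by move=> m [].
  move=> m Cm nC; apply: bit_term0 => am; exact: nC.
rewrite -!/(C _) !adm0 (@reindex_qsum _ _ (drift_rev t) (C a `&` [set m | admissible t m])).
  by apply: eq_qsum => m [_ am]; rewrite bit_term_drift_rev.
have Cdr b (t' : N.-tuple bool) m :
    count id t' = l -> admissible t' m -> C b m -> C (- b) (drift_rev t' m).
  move=> ct' am; rewrite /C /= => Cm; have := cinv1_drift_rev am; rewrite ct' => H.
  suff -> : ((- b)%:~R + l%:R) / (2 * N%:R) + @cinv1 N (drift_rev t' m) =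
    (@cinv1 N m + @cinv1 N (drift_rev t' m) + l%:R / N%:R) -
    ((b%:~R + l%:R) / (2 * N%:R) + @cinv1 N m) by exact: rpredB.
  by rewrite rmorphN /=; field; rewrite nat1r.
split.
- by move=> m [Cm am]; split; [exact: Cdr|exact: admissible_drift_rev].
- move=> m m' /set_mem[_ am] /set_mem[_ am'] mm.
  by rewrite -(drift_revK am) mm drift_revK.
- move=> m [Cm am]; exists (drift_rev (revt t) m); last first.
    by rewrite -{1}(revtK t) drift_revK.
  split; last by rewrite -{1}(revtK t); exact: admissible_drift_rev.
  by rewrite -(opprK a); apply: Cdr => //; rewrite /= count_rev.
Qed.

End FermionicSum.

(** * Theta-like sums *)

Lemma finite_int_le (c : nat) : finite_set [set j : int | (`|j| <= c)%N].
Proof.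
apply: (@sub_finite_set _ _ ((Posz @` `I_c.+1) `|` ((fun k : nat => - k%:Z) @` `I_c.+1))).
  move=> j /= jc; have [j0|j0] := leP 0 j.
    by left; exists `|j|%N; [rewrite /= ltnS|lia].
  by right; exists `|j|%N; [rewrite /= ltnS|lia].
by rewrite finite_setU; split; apply: finite_image; exact: finite_II.
Qed.

Lemma finite_quadratic_le (A B C c : rat) : 0 < A ->
  finite_set [set j : int | A * j%:~R ^+ 2 + B * j%:~R + C <= c].
Proof.
(* For |j| > b one has A |j| > |c - C| + |B| + A and |j| > 1, so A j^2 - |B| |j| exceeds |c - C|. *)
move=> A0; pose b := (`|c - C| / A + `|B| / A + 1)%R.
apply: sub_finite_set (finite_int_le (Num.truncn b)) => j /= jc.
have b0 : 0 <= b by rewrite /b !addr_ge0// divr_ge0// ltW.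
rewrite truncn_ge_nat//.
set x : rat := `|j|%N%:R.
have xE : x = `|j%:~R| by rewrite /x natr_absz intr_norm.
have x0 : 0 <= x by rewrite ler0n.
rewrite leNgt; apply/negP => bx.
have x2 : j%:~R ^+ 2 = x ^+ 2 by rewrite xE real_normK ?num_real.
have Bx : - (`|B| * x) <= B * j%:~R.
  by rewrite xE -normrM lerNl -normrN ler_norm.
have cC : c - C <= `|c - C| by exact: ler_norm.
move: bx; rewrite /b -(ltr_pM2r A0) !mulrDl !divfK ?gt_eqF// mul1r => bx.
rewrite x2 in jc.
have x1 : 1 <= x.
  rewrite leNgt; apply/negP => xl1.
  have := normr_ge0 (c - C); have := normr_ge0 B; nra.
have := normr_ge0 (c - C); have := normr_ge0 B.
nra.
Qed.

Lemma divz_intP (z : int) (d : nat) : (0 < d)%N ->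
  ((z%:~R / d%:R : rat) \is a Num.int) = (d %| z)%Z.
Proof.
move=> d0; have d0' : d%:R != 0 :> rat by rewrite pnatr_eq0 -lt0n.
apply/intrP/dvdzP => -[q zq]; exists q.
  have : z%:~R = (q * d)%:~R :> rat.
    by rewrite intrM -zq divfK.
  by move/intr_inj.
by rewrite zq intrM mulfK.
Qed.

Lemma eqpm_modE N (x y : int) : (0 < N)%N ->
  eqpm_mod N (x%:~R / 2) (y%:~R / 2) =
  (((2 * N)%N %| x - y) || ((2 * N)%N %| x + y))%Z.
Proof.
move=> N0; have N0' : N%:R != 0 :> rat by rewrite pnatr_eq0 -lt0n.
have E (u v : rat) : (u / 2 + v / 2) / N%:R = (u + v) / (2 * N)%N%:R.
  by rewrite natrM; field.
by rewrite /eqpm_mod -!divz_intP ?muln_gt0// intrB intrD -mulNr !E.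
Qed.

(* Up to sign every residue modulo 2N has one representative in [0, N]. *)
Lemma fold_residue N (x : int) : (0 < N)%N -> exists2 i : 'I_N.+1,
  forall i' : 'I_N.+1,
    (((2 * N)%N %| x - Posz i') || ((2 * N)%N %| x + Posz i'))%Z = (i' == i) &
  exists q : int, x = i%:Z + q * N%:R *+ 2 \/ x = - i%:Z + q * N%:R *+ 2.
Proof.
move=> N0.
have [i iN [q xq]] : exists2 i : nat, (i <= N)%N &
    exists q : int, x = i%:Z + q * N%:R *+ 2 \/ x = - i%:Z + q * N%:R *+ 2.
  have D0 : (2 * N)%N%:Z != 0 by lia.
  have := divz_eq x (2 * N)%N; have := modz_ge0 x D0; have := ltz_mod x D0.
  set q := divz _ _; set rr := modz _ _ => h1 h2 h3.
  have [rN|Nr] := leP rr N%:Z.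
    by exists `|rr|%N; [lia|exists q; left; rewrite natz; lia].
  by exists `|(2 * N)%N%:Z - rr|%N; [lia|exists (q + 1); right; rewrite natz; lia].
have iN1 : (i < N.+1)%N by [].
exists (Ordinal iN1); last by exists q.
move=> i'; rewrite -val_eqE /=; apply/orP/eqP => [|->].
  have := ltn_ord i'; move: xq; rewrite natz => xq i'N.
  (* The product of [w] and [N] is nonlinear, so its ranges are listed. As i and i' lie in [0, N],
     the equation for i' - i forces w = 0, and that for i' + i forces w = 0 or w = 1, with i = i' =
     N in the latter case. *)
  have bd w : [\/ w * N%:Z <= - N%:Z, w = 0, w * N%:Z = N%:Z | 2 * N%:Z <= w * N%:Z].
    have [w1|[->|[->|w2]]] : w <= -1 \/ w = 0 \/ w = 1 \/ 2 <= w by lia.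
    - by apply: Or41; nia.
    - exact: Or42.
    - by apply: Or43; rewrite mul1r.
    - by apply: Or44; nia.
  have sub w : (i' : nat)%:Z - i%:Z = 2 * (w * N%:Z) -> i' = i :> nat.
    by case: (bd w) => [|->||] *; lia.
  have add w : (i' : nat)%:Z + i%:Z = 2 * (w * N%:Z) -> i' = i :> nat.
    by case: (bd w) => [|->||] *; lia.
  case=> /dvdzP[u xu]; case: xq => xq.
  - by apply: (sub (q - u)); rewrite mulrBl; lia.
  - by apply: (add (q - u)); rewrite mulrBl; lia.
  - by apply: (add (u - q)); rewrite mulrBl; lia.
  - by apply: (sub (u - q)); rewrite mulrBl; lia.
case: xq; rewrite natz => ->.
  by left; apply/dvdzP; exists q; lia.
by right; apply/dvdzP; exists q; lia.
Qed.

Section ThetaSums.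
Variables (N : nat) (T : int -> qseries) (e0 : rat).
Hypothesis N0 : (0 < N)%N.
Hypothesis T_order : forall a, qord_ge e0 (T a).
Hypothesis T_periodic : forall a (q : int), T (a + q * N%:R *+ 2) = T a.
Hypothesis T_even : forall a, T (- a) = T a.

Definition proper_exponent (e : int -> rat) := forall c, finite_set [set j | e j <= c].

Lemma qsummable_theta e (nu : int -> int) A : proper_exponent e ->
  qsummable A (fun j => qpow (e j) * T (nu j)).
Proof.
move=> pe; apply: (@qsummable_order _ _ _ (fun j => e j + e0)) => [j _|c].
  exact: qord_geM (@qord_ge_pow _) (@T_order _).
by apply: sub_finite_set (pe (c - e0)) => j [_]; rewrite /= lerBrDr.
Qed.

Lemma qsummable_pow e A : proper_exponent e -> qsummable A (fun j => qpow (e j)).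
Proof.
move=> pe; apply: (@qsummable_order _ _ _ e) => [j _|c].
  exact: qord_ge_pow.
by apply: sub_finite_set (pe c) => j [].
Qed.

(** Each [j] meets the condition for exactly one [i], the representative of [nu j] up to sign modulo
    2N, and this [i] has the parity of [nu j]. Periodicity and evenness then give T i = T (nu j). *)
Lemma theta_fold (b : bool) (e : int -> rat) (nu : int -> int) : proper_exponent e ->
    (forall j, odd `|nu j| = b) ->
  \sum_(i < N.+1 | odd i == b)
    T i * qsum [set j | eqpm_mod N ((nu j)%:~R / 2) (i%:R / 2)] (fun j => qpow (e j))
  = qsum setT (fun j => qpow (e j) * T (nu j)).
Proof.
move=> pe nub.
pose A (i : nat) := [set j : int | eqpm_mod N ((nu j)%:~R / 2) (i%:R / 2)].
have sA (i : nat) : qsummable (A i) (fun j => T i * qpow (e j)).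
  by apply: qsummableM; exact: qsummable_pow.
transitivity (\sum_(i < N.+1 | odd i == b)
    qsum setT (fun j => (`[< A i j >])%:R * (T i * qpow (e j)))).
  apply: eq_bigr => i _; rewrite -(qsum_cond (A i)) -qsumMr//.
  exact: qsummable_pow.
have [_ <-] := @qsum_sum _ _ (index_enum _) (fun i : 'I_N.+1 => odd i == b) setT
  (fun i j => (`[< A i j >])%:R * (T i * qpow (e j)))
  (fun i _ => qsummable_cond (sA i)).
apply: eq_qsum => j _; have [i iE [q nuq]] := fold_residue (nu j) N0.
have AE (i' : 'I_N.+1) : `[< A i' j >] = (i' == i).
  rewrite -iE -(eqpm_modE _ _ N0); apply/asboolP/idP => //.
have oi : odd i == b.
  by rewrite -(nub j); apply/eqP; case: nuq; rewrite natz => ->; lia.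
rewrite (bigD1 i)//= big1 ?addr0 => [|i' /andP[_ ii']]; last first.
  by rewrite AE (negbTE ii') mul0r.
rewrite AE eqxx mul1r mulrC; congr (_ * _).
by case: nuq => ->; rewrite T_periodic ?T_even.
Qed.

(** Here [phi j] is to be the position at which the j-th term of alpha sits, so the inner sum over a
    fiber is one half of alpha_L. The weighted sum over [L] becomes a single sum over integers. *)
Lemma qsum_by_fibers (phi : int -> nat) (a : int -> rat) (E : nat -> rat)
    (tau : nat -> int) :
    proper_exponent (fun j => E (phi j) + a j) -> proper_exponent a ->
  let F L := qpow (E L) * qsum [set j | phi j = L] (fun j => qpow (a j)) * T (tau L) in
  qsummable setT F /\
  qsum setT F = qsum setT (fun j => qpow (E (phi j) + a j) * T (tau (phi j))).
Proof.
move=> pEa pa F.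
have FE L : F L = qsum [set j | setT j /\ phi j = L]
    (fun j => qpow (E (phi j) + a j) * T (tau (phi j))).
  have -> : [set j | setT j /\ phi j = L] = [set j | phi j = L].
    by apply/seteqP; split=> j /=; [case|].
  transitivity (qsum [set j | phi j = L] (fun j => (qpow (E L) * T (tau L)) * qpow (a j))).
    by rewrite qsumMr ?/F; [ring|exact: qsummable_pow].
  by apply: eq_qsum => j /= ->; rewrite qpowD; ring.
have -> : F = (fun L => qsum [set j | setT j /\ phi j = L]
    (fun j => qpow (E (phi j) + a j) * T (tau (phi j)))) by apply/funext.
exact/qsum_fibers/qsummable_theta.
Qed.

End ThetaSums.

Lemma proper_quadratic (e : int -> rat) (A B C : rat) : 0 < A ->
  (forall j, e j = A * j%:~R ^+ 2 + B * j%:~R + C) -> proper_exponent e.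
Proof.
move=> A0 eE c; have := @finite_quadratic_le A B C c A0.
by apply: sub_finite_set => j /=; rewrite eE.
Qed.

Lemma proper_opp e : proper_exponent e -> proper_exponent (fun j => e (- j)).
Proof.
move=> pe c; apply: sub_finite_set (finite_image -%R (pe c)) => j /= ej.
by exists (- j) => //; rewrite opprK.
Qed.

(** * Reflecting and splitting sums over the integers *)

Lemma reindex_qsum_opp (F : int -> qseries) :
  qsum setT F = qsum setT (fun j => F (- j)).
Proof.
apply: (@reindex_qsum _ _ -%R setT setT); split=> //.
Qed.

Lemma qsummable_opp (F : int -> qseries) :
  qsummable setT F -> qsummable setT (fun j => F (- j)).
Proof.
move=> sF c; apply: sub_finite_set (finite_image -%R (sF c)) => j [_ Fj].
by exists (- j); rewrite ?opprK.
Qed.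

Lemma qsum_int_split (F : int -> qseries) : qsummable setT F ->
  qsum setT F = qsum [set j | 0 <= j] F + qsum [set j | 1 <= j] (fun j => F (- j)).
Proof.
move=> sF; have TE : [set: int] = [set j | 0 <= j] `|` [set j | j <= -1].
  by apply/seteqP; split=> // j _; case: (lerP 0 j); [left|right => /=; lia].
rewrite {1}TE qsum_setU -?TE//; last first.
  by apply/seteqP; split=> // j [/=]; lia.
congr (_ + _); apply: (@reindex_qsum _ _ -%R [set j : int | 1 <= j]); split.
- by move=> j /=; lia.
- by move=> i j _ _ /oppr_inj.
- by move=> j /= j1; exists (- j); [rewrite /=; lia|rewrite opprK].
Qed.

Lemma qsum_nonneg_split (F : int -> qseries) : qsummable [set j | 0 <= j] F ->
  qsum [set j | 0 <= j] F = F 0 + qsum [set j | 1 <= j] F.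
Proof.
have TE : [set j : int | 0 <= j] = [set 0] `|` [set j | 1 <= j].
  apply/seteqP; split=> j /=; last by case=> [->|]; lia.
  by move=> j0; case: (j =P 0); [left|right => /=; lia].
move=> sF; rewrite {1}TE qsum_setU -?TE ?qsum_set1//.
by apply/seteqP; split=> // j [/= ->].
Qed.

(** * The alpha-sequence *)

(** The L with 2 L + lam = |x|; on the shifts defined next, the truncated subtraction and the
    division are exact. *)
Definition alpha_index (lam : nat) (x : int) : nat := ((`|x| - lam) %/ 2)%N.

Section Shifts.
Variables p' b s : nat.
Hypothesis b_range : (1 <= b <= p' - 1)%N.
Hypothesis s_range : (1 <= s <= p' - 1)%N.

Definition odd_shift (j : int) : int := 2 * (j * p') + b%:Z - s%:Z.
Definition even_shift (j : int) : int := 2 * (j * p') + b%:Z + s%:Z.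

(** |2 j p' + b - s| has the parity of |b - s| and is at least as large, because b and s lie
    strictly between 0 and p'. *)
Lemma odd_shiftE j :
  ((alpha_index `|b - s|%N (odd_shift j)).*2 + `|b - s|)%N = `|odd_shift j|%N.
Proof.
rewrite /alpha_index /odd_shift.
have [j1|[->|j1]] : j <= -1 \/ j = 0 \/ 1 <= j by lia.
- have : j * p' <= - p'%:Z by nia.
  lia.
- lia.
- have : p'%:Z <= j * p' by nia.
  lia.
Qed.

(** The values j = 0 and j = -1 give b + s and 2 p' - b - s, both at least |b - s|; all other [j]
    give larger absolute values. *)
Lemma even_shiftE j :
  ((alpha_index `|b - s|%N (even_shift j)).*2 + `|b - s|)%N = `|even_shift j|%N.
Proof.
rewrite /alpha_index /even_shift.
have [j2|[->|[->|j1]]] : j <= -2 \/ j = -1 \/ j = 0 \/ 1 <= j by lia.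
- have : j * p' <= - 2 * p'%:Z by nia.
  lia.
- lia.
- lia.
- have : p'%:Z <= j * p' by nia.
  lia.
Qed.

End Shifts.

Lemma alpha_delta (L : nat) (x h : int) :
  qdelta L%:R (x%:~R - h%:~R / 2) = (2 * L%:Z + h == 2 * x)%:R.
Proof.
rewrite /qdelta; congr ((_ : bool)%:R); apply/eqP/eqP => H.
  apply: (@intr_inj rat); rewrite rmorphD !rmorphM /= -pmulrn H.
  by field.
have : (2 * L%:Z + h)%:~R = (2 * x)%:~R :> rat by rewrite H.
rewrite rmorphD !rmorphM /= -pmulrn => H'.
have -> : L%:R = (2 * L%:R + h%:~R) / 2 - h%:~R / 2 :> rat by field.
by rewrite H'; field.
Qed.

Section AlphaSequence.
Variables p p' r b s k : nat.
Hypothesis b_range : (1 <= b <= p' - 1)%N.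
Hypothesis s_range : (1 <= s <= p' - 1)%N.

Let lam := `|b - s|%N.
Let pk : int := p%:Z + k%:Z * p'%:Z.
Let rk : int := r%:Z + k%:Z * b%:Z.
Hypothesis pk_gt0 : 0 < pk.
Notation odd_shift := (odd_shift p' b s).
Notation even_shift := (even_shift p' b s).

(** One formula over all integers serves two families of alpha: [odd_power] at -j is the exponent of
    the second positive family, [even_power] at -j that of the second negative one. *)
Definition odd_power (j : int) : int := j * (j * p'%:Z * pk + p'%:Z * rk - s%:Z * pk).
Definition even_power (j : int) : int := (j * p'%:Z + s%:Z) * (j * pk + rk).

Lemma odd_power_proper : proper_exponent (fun j => (odd_power j)%:~R).
Proof.
apply: (@proper_quadratic _ (p'%:Z * pk)%:~R (p'%:Z * rk - s%:Z * pk)%:~R 0).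
  by rewrite ltr0z; nia.
by move=> j; rewrite /odd_power !(rmorphM, rmorphD, rmorphN, rmorphB) /=; ring.
Qed.

Lemma even_power_proper : proper_exponent (fun j => (even_power j)%:~R).
Proof.
apply: (@proper_quadratic _ (p'%:Z * pk)%:~R (p'%:Z * rk + s%:Z * pk)%:~R (s%:Z * rk)%:~R).
  by rewrite ltr0z; nia.
by move=> j; rewrite /even_power !(rmorphM, rmorphD, rmorphN, rmorphB) /=; ring.
Qed.

(** The four families merge into two sums over all integers. The initial delta is the term j = 0 of
    the first sum; otherwise the sign of the shift is determined by [j], so the equation 2 L + lam =
    |shift| selects the position prescribed in alpha. *)
Lemma alphaE (L : nat) : 
  alpha p p' r b s k L =
  qsum [set j | alpha_index lam (odd_shift j) = L] (fun j => qpow (odd_power j)%:~R) -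
  qsum [set j | alpha_index lam (even_shift j) = L] (fun j => qpow (even_power j)%:~R).
Proof.
pose FO (j : int) : qseries :=
  (`[< alpha_index lam (odd_shift j) = L >])%:R * qpow (odd_power j)%:~R.
pose FE (j : int) : qseries :=
  (`[< alpha_index lam (even_shift j) = L >])%:R * qpow (even_power j)%:~R.
have -> : qsum [set j | alpha_index lam (odd_shift j) = L]
  (fun j => qpow (odd_power j)%:~R) = qsum setT FO by rewrite qsum_cond.
have -> : qsum [set j | alpha_index lam (even_shift j) = L]
  (fun j => qpow (even_power j)%:~R) = qsum setT FE by rewrite qsum_cond.
have sO : qsummable setT FO.
  by apply: qsummable_cond; apply: qsummable_pow odd_power_proper.
have sE : qsummable setT FE.
  by apply: qsummable_cond; apply: qsummable_pow even_power_proper.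
have sO0 : qsummable [set j | 0 <= j] FO by apply: sub_qsummable sO.
have sO1 : qsummable [set j | 1 <= j] FO by apply: sub_qsummable sO.
have sNO : qsummable [set j | 1 <= j] (fun j => FO (- j)).
  apply: sub_qsummable (qsummable_opp sO) => //.
have FOE j : FO j = (2 * L%:Z + lam == `|odd_shift j|)%:R * qpow (odd_power j)%:~R.
  rewrite /FO; have -> // : `[< alpha_index lam (odd_shift j) = L >] =
      (2 * L%:Z + lam == `|odd_shift j|).
  by have := odd_shiftE b_range s_range j; rewrite -/lam => oj; apply/asboolP/eqP; lia.
have FEE j : FE j = (2 * L%:Z + lam == `|even_shift j|)%:R * qpow (even_power j)%:~R.
  rewrite /FE; have -> // : `[< alpha_index lam (even_shift j) = L >] =
      (2 * L%:Z + lam == `|even_shift j|).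
  by have := even_shiftE b_range s_range j; rewrite -/lam => oj; apply/asboolP/eqP; lia.
have deltaP (h x y : int) : (2 * L%:Z + h = 2 * x <-> 2 * L%:Z + lam = `|y|) ->
    qdelta L%:R (x%:~R - h%:~R / 2) = (2 * L%:Z + lam == `|y|)%:R.
  by move=> H; rewrite alpha_delta; have -> // :
    (2 * L%:Z + h == 2 * x) = (2 * L%:Z + lam == `|y|); apply/eqP/eqP => /H.
rewrite (qsum_int_split sO) (qsum_int_split sE) (qsum_nonneg_split sO0) /alpha.
rewrite [in RHS]opprD [in RHS]addrA; congr (_ - _ - _).
- rewrite -[RHS]addrA; congr (_ + _).
    rewrite FOE /odd_power mul0r mulr1 /qdelta.
    have -> // : (L%:R == 0 :> rat) = (2 * L%:Z + lam == `|odd_shift 0|).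
    by rewrite pnatr_eq0; apply/eqP/eqP; rewrite /odd_shift /lam; lia.
  rewrite -qsumD//; apply: eq_qsum => j /= j1.
  have jp : p'%:Z <= j * p' by nia.
  have odd_powerN : odd_power (- j) = j * (j * p'%:Z * pk - p'%:Z * rk + s%:Z * pk).
    by rewrite /odd_power; ring.
  rewrite !FOE odd_powerN (@deltaP _ _ (odd_shift j)); last by rewrite /odd_shift /lam; lia.
  rewrite (@deltaP _ _ (odd_shift (- j))); last by rewrite /odd_shift /lam; lia.
  by rewrite ![qpow _ * _]mulrC.
- apply: eq_qsum => j /= j0.
  have jp : 0 <= j * p' by nia.
  rewrite !FEE (@deltaP _ _ (even_shift j)); last by rewrite /even_shift /lam; lia.
  by rewrite mulrC.
- apply: eq_qsum => j /= j1.
  have jp : p'%:Z <= j * p' by nia.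
  have even_powerN : even_power (- j) = (j * p'%:Z - s%:Z) * (j * pk - rk).
    by rewrite /even_power; ring.
  rewrite !FEE even_powerN (@deltaP _ _ (even_shift (- j))); last by rewrite /even_shift /lam; lia.
  by rewrite /pk /rk mulrC.
Qed.
End AlphaSequence.

(** * The flow *)

Lemma string_functionE n l a :
  string_function n.+1 l a =
  qpow (string_exponent n.+1 l) / qpoch_inf * fermi n l a.
Proof. by []. Qed.

(** The leading power of q cancels against that in the string functions, and [theta_fold] collapses
    the sum over residue classes in each of the two parts. *)
Lemma branchingE n l (P P' R S : int) : (l <= n.+1)%N -> 0 < P * P' ->
    odd `|R - S| = odd l ->
  let e1 (j : int) : rat := j%:~R / n.+1%:R * (j * P * P' + P' * R - P * S)%:~R in
  let e2 (j : int) : rat := n.+1%:R^-1 * ((j * P' + S) * (j * P + R))%:~R in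
  [/\ proper_exponent e1, proper_exponent e2 &
  branching n.+1 P P' R S l = qpoch_inf^-1 *
    (qsum setT (fun j => qpow (e1 j) * fermi n l (R - S + 2 * (P' * j))) -
     qsum setT (fun j => qpow (e2 j) * fermi n l (R + S + 2 * (P' * j))))].
Proof.
move=> lN PP odd_RS e1 e2; set N := n.+1.
have N0 : 0 < N%:R :> rat by rewrite ltr0n.
have pe1 : proper_exponent e1.
  apply: (@proper_quadratic _ ((P * P')%:~R / N%:R) ((P' * R - P * S)%:~R / N%:R) 0).
    by rewrite divr_gt0 ?ltr0z.
  move=> j; rewrite /e1 !(rmorphM, rmorphD, rmorphN, rmorphB) /=.
  by rewrite /N; field; rewrite nat1r gt_eqF.
have pe2 : proper_exponent e2.
  apply: (@proper_quadratic _ ((P * P')%:~R / N%:R) ((P' * R + P * S)%:~R / N%:R)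
    ((S * R)%:~R / N%:R)).
    by rewrite divr_gt0 ?ltr0z.
  move=> j; rewrite /e2 !(rmorphM, rmorphD, rmorphN, rmorphB) /=.
  by rewrite /N; field; rewrite nat1r gt_eqF.
split=> //.
have fold e (nu : int -> int) := @theta_fold N (fermi n l) isT
  (fun a q => fermi_periodic n l a q) (fun a => fermi_even a lN) (odd l) e nu.
rewrite -(fold e1 (fun j => R - S + 2 * (P' * j)))//; last by move=> j; lia.
rewrite -(fold e2 (fun j => R + S + 2 * (P' * j)))//; last by move=> j; lia.
rewrite -sumrB mulr_sumr /branching mulr_sumr; apply: eq_bigr => i _.
have muE (a : int) : [set j : int | eqpm_mod N (a%:~R / 2 + (P' * j)%:~R) (i%:R / 2)] =
    [set j : int | eqpm_mod N ((a + 2 * (P' * j))%:~R / 2) (i%:R / 2)].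
  apply/funext => j; rewrite /mkset; congr (is_true (eqpm_mod N _ _)).
  by rewrite !(rmorphM, rmorphD) /=; field.
rewrite /= !muE string_functionE -mulrBr !mulrA -qpowD addNr.
by rewrite -q1E mul1r.
Qed.

(** Evenness removes the absolute value, and periodicity modulo 2N lets [sg] be replaced by any
    integer of the same parity. *)
Lemma fermi_abs n l (x sg rho q : int) : (l <= n.+1)%N -> rho = sg + q *+ 2 ->
  fermi n l (n.+1%:Z * sg - `|x|) = fermi n l (x + n.+1%:Z * rho).
Proof.
move=> lN ->; have -> : x + n.+1%:Z * (sg + q *+ 2) =
    x + n.+1%:Z * sg + q * n.+1%:R *+ 2 by rewrite natz; ring.
rewrite fermi_periodic; have [x0|x0] := lerP 0 x; last first.
  by congr fermi; rewrite ltr0_norm//; ring.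
rewrite ger0_norm// -fermi_even//; have -> : - (n.+1%:Z * sg - x) =
    x + n.+1%:Z * sg + - sg * n.+1%:R *+ 2 by rewrite natz; ring.
by rewrite fermi_periodic.
Qed.

(** 4 u (u + lam) = (2 u + lam)^2 - lam^2 = (z + w)^2 - (z - w)^2 = 4 z w. *)
Lemma mulr_of_squares (u lam : nat) (z w : int) :
  (u.*2 + lam)%N = absz (z + w) -> lam = absz (z - w) ->
  u%:R * (u%:R + lam%:R) = (z * w)%:~R :> rat.
Proof.
move=> H1 H2; have H : u%:Z * (u%:Z + lam%:Z) = z * w.
  have : (u%:Z *+ 2 + lam%:Z) ^+ 2 = (z + w) ^+ 2.
    by rewrite -[RHS]real_normK ?num_real// -abszE -H1 PoszD -muln2 PoszM; ring.
  have : lam%:Z ^+ 2 = (z - w) ^+ 2.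
    by rewrite -[RHS]real_normK ?num_real// -abszE -H2.
  lia.
by rewrite -H rmorphM rmorphD.
Qed.

Theorem mainTheorem1 (p p' r b s N k l sigma : nat)
  (p_ge1 : (1 <= p)%N) (p_lt_p' : (p < p')%N) (p_p' : coprime p p')
  (r_range : (1 <= r <= p - 1)%N)
  (b_range : (1 <= b <= p' - 1)%N) (s_range : (1 <= s <= p' - 1)%N)
  (N_ge1 : (1 <= N)%N) (l_lt_N : (l < N)%N)
  (even_sum : ~~ odd (l + `|b - s| + N * (k * b + r)))
  (sigma_le1 : (sigma <= 1)%N) (sigmaE : sigma = k * b + r %[mod 2]) :
  let lam := `|b - s|%N in
  qpoch_inf^-1 *
  (\qsum_(L \in [set: nat])
     (qpow (L%:R * (L%:R + lam%:R) / N%:R) * alpha p p' r b s k L *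
      \qsum_(eta \in [set eta : {ffun 'I_N.-1 -> nat} |
               (L%:R + (lam%:R - l%:R) / 2) / N%:R - cinv1 eta - sigma%:R / 2
                 \is a Num.int])
        (qpow (cform l eta) / qpochs eta)))
  = branching N p' (p' + N * (p + k * p'))%N s (b + N * (k * b + r))%N l.
Proof.
move=> lam; case: N N_ge1 l_lt_N even_sum => [//|n] _ lN even_sum.
set P' := (p' + _)%N; set S := (b + n.+1 * _)%N.
have l_le : (l <= n.+1)%N := ltnW lN.
have pk0 : 0 < p%:Z + k%:Z * p'%:Z by nia.
have [q rkE] : exists q : int, r%:Z + k%:Z * b%:Z = sigma%:Z + q *+ 2.
  by exists ((k * b + r) %/ 2)%N%:Z; lia.
have PP : 0 < p'%:Z * P' by rewrite /P' -PoszM ltz_nat muln_gt0 addn_gt0; have -> : (0 < p')%N by lia.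
have odd_RS : odd `|s%:Z - S%:Z| = odd l.
  rewrite /S; move: even_sum.
  set w := (n.+1 * _)%N; lia.
have [pe1 pe2 ->] := branchingE l_le PP odd_RS.
set e1 := fun j : int => _ in pe1 *; set e2 := fun j : int => _ in pe2 *.
congr (_ * _).
pose T := fermi n l.
pose E (L : nat) : rat := L%:R * (L%:R + lam%:R) / n.+1%:R.
(* Chosen so that the quantity required to be an integer in [fermi n l (tau L)] is the negative of
   the one in the sum over eta. *)
pose tau (L : nat) : int := n.+1%:Z * sigma%:Z - (L.*2 + lam)%N%:Z.
have innerE (L : nat) : qsum [set eta : {ffun 'I_n -> nat} |
      (L%:R + (lam%:R - l%:R) / 2) / n.+1%:R - @cinv1 n.+1 eta - sigma%:R / 2
         \is a Num.int] (fun eta => qpow (@cform n.+1 l eta) / @qpochs n.+1 eta) = T (tau L).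
  rewrite /T /fermi; congr qsum; apply/funext => eta; rewrite /mkset.
  have -> : ((tau L)%:~R + l%:R) / (2 * n.+1%:R) + @cinv1 n.+1 eta =
      - ((L%:R + (lam%:R - l%:R) / 2) / n.+1%:R - @cinv1 n.+1 eta - sigma%:R / 2).
    rewrite /tau rmorphB rmorphM PoszD -muln2 PoszM !rmorphD !rmorphM /= -!pmulrn.
    by field; rewrite nat1r pnatr_eq0.
  by rewrite rpredN.
(* Here z + w is the shift and z - w = b - s, so L (L + lam) = j p' (j p' + b - s). The linear term
   of the exponent has the opposite sign in the branching function, hence [- j]. *)
have oddE j : E (alpha_index lam (odd_shift p' b s j)) + (odd_power p p' r b s k j)%:~R
    = e1 (- j).
  rewrite /E (@mulr_of_squares _ _ (j * p' + b%:Z - s%:Z) (j * p')).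
  - rewrite /e1 /odd_power /P' /S; rewrite !(PoszD, PoszM).
    rewrite !(rmorphM, rmorphD, rmorphN, rmorphB) /= -!pmulrn.
    by field; rewrite nat1r pnatr_eq0.
  - by rewrite odd_shiftE// /odd_shift; lia.
  - by rewrite /lam; lia.
have evenE j : E (alpha_index lam (even_shift p' b s j)) + (even_power p p' r b s k j)%:~R
    = e2 j.
  rewrite /E (@mulr_of_squares _ _ (j * p' + b%:Z) (j * p' + s%:Z)).
  - rewrite /e2 /even_power /P' /S; rewrite !(PoszD, PoszM).
    rewrite !(rmorphM, rmorphD, rmorphN, rmorphB) /= -!pmulrn.
    by field; rewrite nat1r pnatr_eq0.
  - by rewrite even_shiftE// /even_shift; lia.
  - by rewrite /lam; lia.
have tauO j : T (tau (alpha_index lam (odd_shift p' b s j))) =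
    fermi n l (s%:Z - S%:Z + 2 * (P'%:Z * - j)).
  rewrite /T /tau odd_shiftE// abszE.
  (* Adding N (r + k b + 2 j (p + k p')) to the shift 2 j p' + b - s gives 2 j P' + S - s, and the
     integer multiplied by N has the parity of [sigma]. Evenness then reverses the sign. *)
  rewrite (@fermi_abs _ _ _ _ (r%:Z + k%:Z * b%:Z + (j * (p%:Z + k%:Z * p'%:Z)) *+ 2)
    (q + j * (p%:Z + k%:Z * p'%:Z)))//; last by rewrite rkE; ring.
  rewrite -[RHS]fermi_even//; congr fermi.
  by rewrite /odd_shift /P' /S !(PoszD, PoszM); ring.
have tauE j : T (tau (alpha_index lam (even_shift p' b s j))) =
    fermi n l (s%:Z + S%:Z + 2 * (P'%:Z * j)).
  rewrite /T /tau even_shiftE// abszE.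
  rewrite (@fermi_abs _ _ _ _ (r%:Z + k%:Z * b%:Z + (j * (p%:Z + k%:Z * p'%:Z)) *+ 2)
    (q + j * (p%:Z + k%:Z * p'%:Z)))//; last by rewrite rkE; ring.
  congr fermi.
  by rewrite /even_shift /P' /S !(PoszD, PoszM); ring.
have Torder a : qord_ge (- exponent_gap n) (T a) by exact: fermi_order.
have pO : proper_exponent (fun j =>
    E (alpha_index lam (odd_shift p' b s j)) + (odd_power p p' r b s k j)%:~R).
  by rewrite (funext oddE); exact: proper_opp.
have pE : proper_exponent (fun j =>
    E (alpha_index lam (even_shift p' b s j)) + (even_power p p' r b s k j)%:~R).
  by rewrite (funext evenE).
have [sO sumO] := qsum_by_fibers Torder tau pO (odd_power_proper r b_range s_range pk0).
have [sE sumE] := qsum_by_fibers Torder tau pE (even_power_proper r b_range s_range pk0).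
(* The reflection matches the index [- j] in [oddE] and [tauO]. *)
rewrite [in RHS](reindex_qsum_opp (fun j => qpow (e1 j) * _)).
transitivity (qsum setT (fun L =>
   qpow (E L) * qsum [set j | alpha_index lam (odd_shift p' b s j) = L]
      (fun j => qpow (odd_power p p' r b s k j)%:~R) * T (tau L)
 - qpow (E L) * qsum [set j | alpha_index lam (even_shift p' b s j) = L]
      (fun j => qpow (even_power p p' r b s k j)%:~R) * T (tau L))).
  apply: eq_qsum => L _; rewrite innerE alphaE// -/lam; ring.
rewrite qsumB// sumO sumE; congr (_ - _); apply: eq_qsum => j _.
  by rewrite oddE tauO.
by rewrite evenE tauE.
Qed.
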